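(* For all positive integers $n\ge 3$ and $2\le d\le n^2-3$, the quantum automorphism group $\mathrm{Qut}(\mathcal{S}\le M_n)$ is trivial for generic operator $d$-systems $\mathcal{S}\le M_n$.
   Context: $M_n$ is the algebra of $n\times n$ complex matrices with its (normalized) trace $\tau$. For a compact quantum group $\mathrm{G}$, $\mathcal{O}(\mathrm{G})$ is its CQG algebra; quantum subgroups correspond to quotient CQG algebras; $\mathrm{G}$ is trivial if $\mathcal{O}(\mathrm{G})=\mathbb{C}$. $\mathrm{Qut}(M_n,\tau)$ is the quantum automorphism group: the universal compact quantum group acting on $M_n$ by a $\tau$-preserving unital $*$-homomorphic coaction $\alpha:M_n\to M_n\otimes\mathcal{O}(\mathrm{Qut}(M_n,\tau))$. An operator system $\mathcal{S}\le M_n$ is a unital self-adjoint complex subspace; an operator $d$-system is one of dimension $d+1$. $\mathrm{Qut}(\mathcal{S}\le M_n)$ is the largest quantum subgroup of $\mathrm{Qut}(M_n,\tau)$ preserving $\mathcal{S}$ (i.e. $\alpha(\mathcal{S})\subseteq\mathcal{S}\otimes\mathcal{O}$). A property of operator $d$-systems $\mathcal{S}=\mathbb{C}1+\mathcal{W}$ holds generically (for generic $\mathcal{S}$) if it holds for $\mathcal{W}$ ranging over a non-empty open set in the real Zariski topology on the Grassmannian $\mathbb{G}_{sa}(d,M_n)$ of $d$-dimensional self-adjoint complex subspaces of $M_n$. *)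

(* Defs.v *)
From HB Require Import structures.
From mathcomp Require Import all_boot all_order all_algebra.
From mathcomp Require Import generic_quotient sesquilinear.
From mathcomp Require Import boolp reals complex.
From mathcomp Require mpoly.

Set Implicit Arguments.
Unset Strict Implicit.
Unset Printing Implicit Defensive.

Import Order.TTheory GRing.Theory Num.Theory.

Local Open Scope ring_scope.
Local Open Scope quotient_scope.
Local Open Scope sesquilinear_scope.

Declare Scope tensor_scope.
Local Open Scope tensor_scope.

(* mpoly is not imported at top level: its notations clash with others. *)
Module MPoly.
Import mpoly.
Definition homogeneous (N : nat) (K : nzRingType) (k : nat)
  (p : {mpoly K[N]}) : bool := p \is k.-homog.
Definition eval (N : nat) (K : nzRingType) (v : 'I_N -> K)
  (p : {mpoly K[N]}) : K := p.@[v].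
End MPoly.

(******************************************************************************)
(* Tensor product of two modules over a commutative ring: finite formal sums  *)
(* of pairs, two sums being identified when every balanced biadditive map     *)
(* into an abelian group takes the same value on them.                        *)
(******************************************************************************)

Section Tensor.
Variables (K : comNzRingType) (A B : lmodType K).

Definition balanced (V : zmodType) (f : A -> B -> V) : Prop :=
  [/\ forall a a' b, f (a + a') b = f a b + f a' b,
      forall a b b', f a (b + b') = f a b + f a b' &
      forall c a b, f (c *: a) b = f a (c *: b)].

Definition tsum (V : zmodType) (f : A -> B -> V) (s : seq (A * B)) : V :=
  \sum_(p <- s) f p.1 p.2.

Definition tequiv (s t : seq (A * B)) : bool :=
  `[< forall (V : zmodType) (f : A -> B -> V),
        balanced f -> tsum f s = tsum f t >].

Lemma tequiv_refl : reflexive tequiv.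
Proof. by move=> s; apply/asboolP. Qed.

Lemma tequiv_sym : symmetric tequiv.
Proof.
by move=> s t; apply/asboolP/asboolP => h V f fb; apply/esym/h.
Qed.

Lemma tequiv_trans : transitive tequiv.
Proof.
move=> t s u /asboolP hs /asboolP ht; apply/asboolP => V f fb.
by rewrite hs // ht.
Qed.

Canonical tequiv_equiv := EquivRel tequiv tequiv_refl tequiv_sym tequiv_trans.

Definition tensor := {eq_quot tequiv_equiv}.
HB.instance Definition _ := Choice.on tensor.
HB.instance Definition _ := Quotient.on tensor.

Definition tpure (a : A) (b : B) : tensor := \pi_tensor [:: (a, b)].

Definition tlift (V : zmodType) (f : A -> B -> V) (x : tensor) : V :=
  tsum f (repr x).

Lemma tensor_eqP (s t : seq (A * B)) :
  \pi_tensor s = \pi_tensor t <->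
  forall (V : zmodType) (f : A -> B -> V),
    balanced f -> tsum f s = tsum f t.
Proof.
split; first by move/eqmodP => /asboolP.
by move=> h; apply/eqmodP/asboolP.
Qed.

Lemma tlift_pi (V : zmodType) (f : A -> B -> V) s :
  balanced f -> tlift f (\pi_tensor s) = tsum f s.
Proof.
move=> fb; have /tensor_eqP : \pi_tensor (repr (\pi_tensor s)) = \pi_tensor s.
  by rewrite reprK.
exact.
Qed.

Let tzero : tensor := \pi_tensor [::].
Let tadd (x y : tensor) : tensor := \pi_tensor (repr x ++ repr y).
Let tscale (c : K) (x : tensor) : tensor :=
  \pi_tensor [seq (c *: p.1, p.2) | p <- repr x].
Let topp (x : tensor) : tensor := tscale (- 1) x.

Let tensorP (x y : tensor) :
  (forall (V : zmodType) (f : A -> B -> V),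
     balanced f -> tlift f x = tlift f y) -> x = y.
Proof.
by move=> h; rewrite -[x]reprK -[y]reprK; apply/tensor_eqP => V f /h.
Qed.

Let lift_zero (V : zmodType) (f : A -> B -> V) :
  balanced f -> tlift f tzero = 0.
Proof. by move=> fb; rewrite tlift_pi // /tsum big_nil. Qed.

Let lift_add (V : zmodType) (f : A -> B -> V) x y :
  balanced f -> tlift f (tadd x y) = tlift f x + tlift f y.
Proof. by move=> fb; rewrite tlift_pi // /tsum big_cat. Qed.

Let balancedZ (V : zmodType) (f : A -> B -> V) c :
  balanced f -> balanced (fun a b => f (c *: a) b).
Proof.
case=> fl fr fc; split=> [a a' b|a b b'|d a b]; rewrite ?scalerDr ?fl ?fr //.
by rewrite scalerA mulrC -scalerA fc.
Qed.

Let lift_scale (V : zmodType) (f : A -> B -> V) c x :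
  balanced f -> tlift f (tscale c x) = tlift (fun a b => f (c *: a) b) x.
Proof. by move=> fb; rewrite tlift_pi // /tsum big_map. Qed.

Let lift_opp (V : zmodType) (f : A -> B -> V) x :
  balanced f -> tlift f (topp x) = - tlift f x.
Proof.
move=> fb; rewrite lift_scale // /tlift /tsum -sumrN; apply: eq_bigr => p _.
apply/(addrI (f p.1 p.2)); rewrite subrr; case: fb => fl fr fc.
rewrite scaleN1r -fl subrr; apply/(addrI (f 0 p.2)).
by rewrite -fl !addr0.
Qed.

Let taddA : associative tadd.
Proof. by move=> x y z; apply: tensorP => V f fb; rewrite !lift_add // addrA. Qed.
Let taddC : commutative tadd.
Proof. by move=> x y; apply: tensorP => V f fb; rewrite !lift_add // addrC. Qed.
Let tadd0 : left_id tzero tadd.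
Proof.
by move=> x; apply: tensorP => V f fb; rewrite lift_add // lift_zero // add0r.
Qed.
Let taddN : left_inverse tzero topp tadd.
Proof.
move=> x; apply: tensorP => V f fb.
by rewrite lift_add // lift_opp // lift_zero // addNr.
Qed.

HB.instance Definition _ := GRing.isZmodule.Build tensor taddA taddC tadd0 taddN.

Let tscaleA c d x : tscale c (tscale d x) = tscale (c * d) x.
Proof.
apply: tensorP => V f fb; rewrite !lift_scale //; last exact: balancedZ.
rewrite /tlift /tsum; apply: eq_bigr => p _.
by rewrite scalerA.
Qed.
Let tscale1 : left_id 1 tscale.
Proof.
move=> x; apply: tensorP => V f fb; rewrite lift_scale //.
by apply: eq_bigr => p _; rewrite scale1r.
Qed.
Let tscaleDr : right_distributive tscale +%R.
Proof.
move=> c x y; apply: tensorP => V f fb.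
by rewrite !(lift_add, lift_scale) //; exact: balancedZ.
Qed.
Let tscaleDl x : {morph tscale^~ x : c d / c + d}.
Proof.
move=> c d; apply: tensorP => V f fb; rewrite !(lift_add, lift_scale) //.
rewrite /tlift /tsum -big_split; apply: eq_bigr => p _ /=.
by rewrite scalerDl; case: fb.
Qed.

HB.instance Definition _ :=
  GRing.Zmodule_isLmodule.Build K tensor tscaleA tscale1 tscaleDr tscaleDl.

Lemma tlift_tpure (V : zmodType) (f : A -> B -> V) a b :
  balanced f -> tlift f (tpure a b) = f a b.
Proof. by move=> fb; rewrite tlift_pi // /tsum big_seq1. Qed.

Lemma tliftD (V : zmodType) (f : A -> B -> V) :
  balanced f -> {morph tlift f : x y / x + y}.
Proof. by move=> fb x y; exact: lift_add. Qed.

Lemma tliftZ (V : lmodType K) (f : A -> B -> V) :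
  bilinear_for *:%R *:%R f -> scalable (tlift f).
Proof.
move=> [fl fr].
have fZl c a b : f (c *: a) b = c *: f a b.
  by have := scalable_linear (fl b) c a.
have fDl a a' b : f (a + a') b = f a b + f a' b.
  by have /= := fl b 1 a a'; rewrite !scale1r.
have fZr c a b : f a (c *: b) = c *: f a b.
  by have := scalable_linear (fr a) c b.
have fDr a b b' : f a (b + b') = f a b + f a b'.
  by have /= := fr a 1 b b'; rewrite !scale1r.
move=> c x; rewrite lift_scale; last by split=> // d a b; rewrite fZl fZr.
by rewrite /tlift /tsum scaler_sumr; apply: eq_bigr => p _; rewrite fZl.
Qed.

Lemma tpure_bilinear : bilinear_for *:%R *:%R tpure.
Proof.
split=> [b|a] c x y; apply: tensorP => V f fb.
  rewrite lift_add // lift_scale // !tlift_tpure //; last exact: balancedZ.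
  by case: fb.
rewrite lift_add // lift_scale // !tlift_tpure //; last exact: balancedZ.
by case: fb => fl fr fc; rewrite fr fc.
Qed.

Lemma tensor_sum_pure (x : tensor) : x = \sum_(p <- repr x) tpure p.1 p.2.
Proof.
apply: tensorP => V f fb; rewrite {1}/tlift /tsum.
elim: (repr x) => [|p s IH]; first by rewrite !big_nil lift_zero.
by rewrite !big_cons lift_add // tlift_tpure // IH.
Qed.

End Tensor.

Notation "A ⊗ B" := (tensor A B) (at level 40, left associativity) :
  type_scope.
Notation "a ⊗ b" := (tpure a b) (at level 40, left associativity) :
  tensor_scope.

Section TensorMaps.
Variable K : comNzRingType.

Lemma bilinear_balanced (A B V : lmodType K) (f : A -> B -> V) :
  bilinear_for *:%R *:%R f -> balanced f.
Proof.
move=> [fl fr]; split=> [a a' b|a b b'|c a b].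
- by have /= := fl b 1 a a'; rewrite !scale1r.
- by have /= := fr a 1 b b'; rewrite !scale1r.
- by rewrite (scalable_linear (fr a)); exact: (scalable_linear (fl b)).
Qed.

Definition tmap (A B A' B' : lmodType K) (f : A -> A') (g : B -> B') :
    (A ⊗ B)%type -> (A' ⊗ B')%type :=
  tlift (fun a b => f a ⊗ g b).

Definition tassoc (A B D : lmodType K) :
    ((A ⊗ B) ⊗ D)%type -> (A ⊗ (B ⊗ D))%type :=
  tlift (fun x d => tlift (fun a b => a ⊗ (b ⊗ d)) x).

Definition tmul (A B : algType K) (x y : (A ⊗ B)%type) : (A ⊗ B)%type :=
  tlift (fun a b => tlift (fun a' b' => (a * a') ⊗ (b * b')) y) x.

Let pD1 (A B : lmodType K) (a a' : A) (b : B) :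
  (a + a') ⊗ b = a ⊗ b + a' ⊗ b.
Proof. by case: (bilinear_balanced (@tpure_bilinear K A B)). Qed.
Let pD2 (A B : lmodType K) (a : A) (b b' : B) :
  a ⊗ (b + b') = a ⊗ b + a ⊗ b'.
Proof. by case: (bilinear_balanced (@tpure_bilinear K A B)). Qed.
Let pZ1 (A B : lmodType K) c (a : A) (b : B) : (c *: a) ⊗ b = c *: (a ⊗ b).
Proof. exact: (scalable_linear ((@tpure_bilinear K A B).1 b)). Qed.
Let pZ2 (A B : lmodType K) c (a : A) (b : B) : a ⊗ (c *: b) = c *: (a ⊗ b).
Proof. exact: (scalable_linear ((@tpure_bilinear K A B).2 a)). Qed.

Lemma tmapE (A B A' B' : lmodType K) (f : {linear A -> A'})
    (g : {linear B -> B'}) a b : tmap f g (a ⊗ b) = f a ⊗ g b.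
Proof.
rewrite /tmap tlift_tpure //; split=> *; rewrite ?linearD ?pD1 ?pD2 //.
by rewrite !linearZ pZ1 pZ2.
Qed.

Lemma tassocE (A B D : lmodType K) (a : A) (b : B) (d : D) :
  tassoc ((a ⊗ b) ⊗ d) = a ⊗ (b ⊗ d).
Proof.
have bal d' : balanced (fun (a : A) (b : B) => a ⊗ (b ⊗ d')).
  by split=> *; rewrite ?(pD1, pD2, pZ1, pZ2).
rewrite /tassoc tlift_tpure ?tlift_tpure //; split=> [x y e|x e e'|c x e].
- exact: tliftD.
- rewrite /tlift /tsum -big_split; apply: eq_bigr => p _ /=.
  by rewrite !pD2.
- rewrite tliftZ; last by split=> ? ? ? ?; rewrite /= ?(pD1, pD2, pZ1, pZ2).
  rewrite /tlift /tsum scaler_sumr; apply: eq_bigr => p _ /=.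
  by rewrite !pZ2.
Qed.

Lemma tmulE (A B : algType K) (a a' : A) (b b' : B) :
  tmul (a ⊗ b) (a' ⊗ b') = (a * a') ⊗ (b * b').
Proof.
have bal c d : balanced (fun (a' : A) (b' : B) => (c * a') ⊗ (d * b')).
  by split=> *; rewrite ?(mulrDr, pD1, pD2) // -!scalerAr pZ1 pZ2.
rewrite /tmul tlift_tpure ?tlift_tpure //; split=> [x y e|x e e'|c x e].
- rewrite /tlift /tsum -big_split; apply: eq_bigr => p _ /=.
  by rewrite mulrDl pD1.
- rewrite /tlift /tsum -big_split; apply: eq_bigr => p _ /=.
  by rewrite mulrDl pD2.
- rewrite /tlift /tsum; apply: eq_bigr => p _ /=.
  by rewrite -!scalerAl pZ1 pZ2.
Qed.

End TensorMaps.

(******************************************************************************)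
(* CQG algebras: Hopf *-algebras over C = R[i] that are the linear span of    *)
(* the coefficients of their finite-dimensional unitary corepresentations.    *)
(******************************************************************************)

Record is_hopf_star (R : realType) (A : algType R[i]) (star : A -> A)
    (comul : A -> (A ⊗ A)%type) (counit : A -> R[i]) (antipode : A -> A) :
    Prop := {
  starD : {morph star : a b / a + b};
  starZ : forall (c : R[i]) a, star (c *: a) = c^* *: star a;
  starM : forall a b, star (a * b) = star b * star a;
  starK : involutive star;
  comul1 : comul 1 = 1 ⊗ 1;
  comulM : forall a b, comul (a * b) = tmul (comul a) (comul b);
  comul_star : forall a, comul (star a) = tmap star star (comul a);
  counit_star : forall a, counit (star a) = (counit a)^*;
  comulA : forall a, tassoc (tmap comul id (comul a)) = tmap id comul (comul a);
  counitl : forall a, tlift (fun x y => counit x *: y) (comul a) = a;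
  counitr : forall a, tlift (fun x y => counit y *: x) (comul a) = a;
  antipodel : forall a,
    tlift (fun x y => antipode x * y) (comul a) = (counit a)%:A;
  antipoder : forall a,
    tlift (fun x y => x * antipode y) (comul a) = (counit a)%:A
}.

Record hopfStarAlgebra (R : realType) := HopfStarAlgebra {
  hopf_alg :> algType R[i];
  star : hopf_alg -> hopf_alg;
  comul : {linear hopf_alg -> (hopf_alg ⊗ hopf_alg)%type};
  counit : {lrmorphism hopf_alg -> R[i]^o};
  antipode : {linear hopf_alg -> hopf_alg};
  hopf_starP : is_hopf_star star comul counit antipode
}.

Section CQG.
Variable R : realType.

Definition corepresentation (A : hopfStarAlgebra R) m (v : 'M[A]_m) : Prop :=
  (forall i j, comul A (v i j) = \sum_k v i k ⊗ v k j) /\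
  (forall i j, counit A (v i j) = (i == j)%:R).

Definition unitary (A : hopfStarAlgebra R) m (v : 'M[A]_m) : Prop :=
  v *m v ^t (@star R A) = 1%:M /\ v ^t (@star R A) *m v = 1%:M.

Definition unitary_coefficient (A : hopfStarAlgebra R) (a : A) : Prop :=
  exists m (v : 'M[A]_m),
    [/\ corepresentation v, unitary v & exists i j, a = v i j].

Record cqgAlgebra := CQGAlgebra {
  cqg_hopf :> hopfStarAlgebra R;
  cqg_span : forall a : cqg_hopf, exists s : seq (R[i] * cqg_hopf),
    (forall p, p \in s -> unitary_coefficient p.2) /\
    a = \sum_(p <- s) p.1 *: p.2
}.

Definition is_cqg_morphism (A B : cqgAlgebra) (f : {lrmorphism A -> B}) : Prop :=
  [/\ forall a, f (star a) = star (f a),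
      forall a, comul B (f a) = tmap f f (comul A a) &
      forall a, counit B (f a) = counit A a].

(* Below a compact quantum group is given by its CQG algebra O(G), so the     *)
(* arrows are reversed: a quantum subgroup is a surjective morphism out of    *)
(* O(G).                                                                      *)
Definition is_quantum_subgroup (G H : cqgAlgebra) (r : {lrmorphism G -> H}) :
    Prop :=
  is_cqg_morphism r /\ forall b : H, exists a : G, r a = b.

Definition trivial_qgroup (G : cqgAlgebra) : Prop :=
  forall a : G, exists c : R[i], a = c%:A.

(******************************************************************************)
(* Actions on M_n, with M_n (x) A identified with the n x n matrices over A.  *)
(******************************************************************************)

Section Actions.
Variable n : nat.
Local Notation Mn := 'M[R[i]]_n.

Definition mxtens (A : algType R[i]) (x : Mn) (a : A) : 'M[A]_n :=
  \matrix_(i, j) (x i j *: a).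

(* (tau (x) id), for tau the normalized trace. *)
Definition mxtau (A : algType R[i]) (X : 'M[A]_n) : A :=
  (n%:R : R[i])^-1 *: \tr X.

Definition ntr (x : Mn) : R[i] := n%:R^-1 * \tr x.

(* The coassociativity axiom compares (id (x) comul)(alpha x), on the left,   *)
(* with (alpha (x) id)(alpha x), where alpha x = sum_(k, l) E_kl (x) X_kl.    *)
Record is_tau_action (G : cqgAlgebra) (alpha : Mn -> 'M[G]_n) : Prop := {
  action_linear : forall (c : R[i]) (x y : Mn),
    alpha (c *: x + y) = map_mx ( *:%R c) (alpha x) + alpha y;
  action1 : alpha 1%:M = 1%:M;
  actionM : forall x y : Mn, alpha (x *m y) = alpha x *m alpha y;
  action_star : forall x, alpha (x ^t Num.conj) = (alpha x) ^t (@star R G);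
  action_coassoc : forall x,
    map_mx (comul G) (alpha x) =
    \matrix_(i, j) \sum_k \sum_l alpha (delta_mx k l) i j ⊗ alpha x k l;
  action_counit : forall x, map_mx (counit G : G -> R[i]) (alpha x) = x;
  action_tau : forall x, mxtau (alpha x) = (ntr x)%:A
}.

(* G, acting by alpha, is Qut(M_n, tau). *)
Definition is_Qut (G : cqgAlgebra) (alpha : Mn -> 'M[G]_n) : Prop :=
  is_tau_action alpha /\
  forall (H : cqgAlgebra) (beta : Mn -> 'M[H]_n), is_tau_action beta ->
    exists f : {lrmorphism G -> H},
      [/\ is_cqg_morphism f,
          forall x, map_mx f (alpha x) = beta x &
          forall g : {lrmorphism G -> H}, is_cqg_morphism g ->
            (forall x, map_mx g (alpha x) = beta x) -> g =1 f].

Definition in_tensor (S : {vspace Mn}) (A : algType R[i]) (X : 'M[A]_n) : Prop :=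
  exists s : seq (Mn * A),
    (forall p, p \in s -> p.1 \in S) /\ X = \sum_(p <- s) mxtens p.1 p.2.

Definition preserves (S : {vspace Mn}) (G : cqgAlgebra)
    (alpha : Mn -> 'M[G]_n) : Prop :=
  forall x, x \in S -> in_tensor S (alpha x).

Definition restrict_action (G H : cqgAlgebra) (r : G -> H)
    (alpha : Mn -> 'M[G]_n) : Mn -> 'M[H]_n :=
  fun x => map_mx r (alpha x).

(* For (G, alpha) = Qut(M_n, tau), the quantum subgroup (H, r) is             *)
(* Qut(S <= M_n).                                                             *)
Definition is_Qut_opsys (G : cqgAlgebra) (alpha : Mn -> 'M[G]_n)
    (S : {vspace Mn}) (H : cqgAlgebra) (r : {lrmorphism G -> H}) : Prop :=
  [/\ is_quantum_subgroup r, preserves S (restrict_action r alpha) &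
      forall (K : cqgAlgebra) (q : {lrmorphism G -> K}),
        is_quantum_subgroup q -> preserves S (restrict_action q alpha) ->
        exists f : {lrmorphism H -> K},
          is_cqg_morphism f /\ forall a, f (r a) = q a].

Definition Qut_opsys_trivial (S : {vspace Mn}) : Prop :=
  forall (G : cqgAlgebra) (alpha : Mn -> 'M[G]_n), is_Qut alpha ->
    (exists (H : cqgAlgebra) (r : {lrmorphism G -> H}),
       is_Qut_opsys alpha S r) /\
    (forall (H : cqgAlgebra) (r : {lrmorphism G -> H}),
       is_Qut_opsys alpha S r -> trivial_qgroup H).

Definition self_adjoint_space (S : {vspace Mn}) : Prop :=
  forall x, x \in S -> x ^t Num.conj \in S.

Definition operator_system (S : {vspace Mn}) : Prop :=
  1%:M \in S /\ self_adjoint_space S.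

Definition operator_dsystem (d : nat) (S : {vspace Mn}) : Prop :=
  operator_system S /\ \dim S = d.+1.

(******************************************************************************)
(* The Grassmannian of self-adjoint subspaces is the real Grassmannian of the *)
(* n^2-dimensional real space of self-adjoint matrices; its Zariski topology  *)
(* is the one of its Pluecker embedding.                                      *)
(******************************************************************************)

Definition Gsa (d : nat) (W : {vspace Mn}) : Prop :=
  self_adjoint_space W /\ \dim W = d.

Definition sa_basis (d : nat) (W : {vspace Mn}) (w : d.-tuple Mn) : Prop :=
  basis_of W w /\ forall i, (tnth w i) ^t Num.conj = tnth w i.

(* Real coordinates of a self-adjoint matrix: the real parts on and above the *)
(* diagonal, the imaginary parts below it.                                    *)
Definition sa_coord (x : Mn) : 'rV[R]_(n * n) :=
  mxvec (\matrix_(i, j) if (i <= j)%N then complex.Re (x i j)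
                        else complex.Im (x i j)).

(* The maximal minors are indexed by all the d-tuples of columns, rather than *)
(* the increasing ones: the extra minors are zero or repeat others up to      *)
(* sign.                                                                      *)
Definition pluecker_index (d : nat) := {ffun 'I_d -> 'I_(n * n)}.

Definition pluecker (d : nat) (w : d.-tuple Mn) (s : pluecker_index d) : R :=
  \det (\matrix_(i < d, j < d) sa_coord (tnth w i) 0 (s j)).

Definition pluecker_form (d : nat) := mpoly.mpoly #|{: pluecker_index d}| R.

Definition pluecker_eval (d : nat) (w : d.-tuple Mn) (p : pluecker_form d) : R :=
  MPoly.eval (fun i => pluecker w (enum_val i)) p.

Definition zariski_closed (d : nat) (Z : {vspace Mn} -> Prop) : Prop :=
  exists F : pluecker_form d -> Prop,
    (forall p, F p -> exists k, MPoly.homogeneous k p) /\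
    forall W, Z W <->
      Gsa d W /\ forall w : d.-tuple Mn, sa_basis W w ->
        forall p, F p -> pluecker_eval w p = 0.

Definition zariski_open (d : nat) (U : {vspace Mn} -> Prop) : Prop :=
  (forall W, U W -> Gsa d W) /\ zariski_closed d (fun W => Gsa d W /\ ~ U W).

Definition generic_dsystem (d : nat) (P : {vspace Mn} -> Prop) : Prop :=
  exists U : {vspace Mn} -> Prop,
    [/\ zariski_open d U, exists W, U W &
        forall W, U W ->
          operator_dsystem d (<[1%:M]> + W) /\ P (<[1%:M]> + W)%VS].

End Actions.
End CQG.

(* Main.v *)
Require Import Defs.
From HB Require Import structures.
From mathcomp Require Import all_boot all_order all_algebra perm.
From mathcomp Require Import sesquilinear boolp reals complex.
From mathcomp Require mpoly.
From mathcomp Require Import ring zify.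

(** An action preserving the operator system [S] commutes with the orthogonal
    projection [P] on [S], because the matrix of the action has its adjoint as
    inverse. Hence the set of fixed vectors, a unital algebra, is stable under [P]
    and under [v |-> \sum_b b v b], where [b] runs over an orthonormal basis of [S].
    If these operations generate [M_n] from [1], the action is trivial, and so is
    the quantum automorphism group. That given expressions in these operations span
    [M_n] is the non-vanishing of a determinant whose entries are polynomials in the
    Pluecker coordinates, up to powers of one of them; so for each dimension one
    example suffices.

    In the example, [S] is the sum of a diagonal part and of a space of imaginary
    antisymmetric matrices: a span of edges [i (E_kl - E_lk)], enlarged or
    diminished by the line of [y = i K], with [K] a weighted non-bipartite graph.
    Then [P (\sum_b b ^ 2)] is diagonal with distinct entries, so the [E_kk] are
    generated, and the compressions [E_ii y E_kk y E_jj] give the other matrix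
    units. The large dimensions are reached because [S] and the sum of [C 1] and
    the orthogonal complement of [S] generate the same algebra. *)

Set Implicit Arguments.
Unset Strict Implicit.
Unset Printing Implicit Defensive.

Import Order.TTheory GRing.Theory Num.Theory.
Local Open Scope ring_scope.
Local Open Scope sesquilinear_scope.
Local Open Scope tensor_scope.

(** * Fixed vectors of an action *)

(** Orthogonality refers to the bilinear form [\tr (x *m y)], because multiplicativity and
    invariance of the trace make a coaction preserve exactly this form. On a self-adjoint subspace
    it is non-degenerate, and its projection is the Hilbert-Schmidt one. That projection is only
    rational in the subspace; multiplied by the Gram determinant it becomes polynomial, so the
    fixed-point argument is run for a multiple [g] of a projection. The resulting determinant is
    complex on a real Grassmannian: the squares of its real and imaginary parts are added to get one
    real form. In the example, the edges contribute half-integers to the diagonal of the sandwich of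
    [1], and the line of [K] contributes fractions smaller than [1/2]. The fractions tell the
    vertices apart whichever edges are chosen, so the number of edges is free to adjust the
    dimension. The bounds on [d] are exchanged by [d |-> n ^ 2 - 1 - d], the effect of
    complementation. *)

Section Terms.
Variables (R : realType) (n : nat).
Local Notation F := R[i].
Local Notation Mn := 'M[F]_n.

(* If [P] is the orthogonal projection on a space with orthonormal basis [b_k] *)
(* for the trace form, this is [v |-> \sum_k b_k *m v *m b_k].                 *)
Definition sandwich (P : Mn -> Mn) (v : Mn) : Mn :=
  \matrix_(i, j) \sum_p \sum_q P (delta_mx j q) i p * v p q.

(** Expressions are kept as syntax because one family of them, found on the example, is then
    evaluated at the projections of all the other subspaces. *)
Inductive term :=
  | One
  | Add of term & term
  | Scale of F & term
  | Mul of term & term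
  | Proj of term
  | Sandwich of term.

Fixpoint term_eval (P : Mn -> Mn) (t : term) : Mn :=
  match t with
  | One => 1%:M
  | Add t u => term_eval P t + term_eval P u
  | Scale c t => c *: term_eval P t
  | Mul t u => term_eval P t *m term_eval P u
  | Proj t => P (term_eval P t)
  | Sandwich t => sandwich P (term_eval P t)
  end.

(** For a map commuting with the adjoint of matrices, this is self-adjointness for the
    Hilbert-Schmidt product. *)
Definition trace_symmetric (P : Mn -> Mn) : Prop :=
  forall x y, \tr (P x *m y) = \tr (x *m P y).

Lemma mxtrace_delta (x : Mn) i j : \tr (delta_mx i j *m x) = x j i.
Proof.
rewrite /mxtrace (bigD1 i) //= mxE (bigD1 j) //= mxE !eqxx mul1r.
rewrite !big1 ?addr0 // => k /negbTE nk.
  by rewrite mxE big1 // => l _; rewrite mxE nk mul0r.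
by rewrite mxE nk andbF mul0r.
Qed.

Lemma trace_symmetric_delta P i j k l : trace_symmetric P ->
  P (delta_mx k l) i j = P (delta_mx j i) l k.
Proof. by move=> Psym; rewrite -mxtrace_delta -Psym mxtrace_mulC mxtrace_delta. Qed.

Lemma linear_delta (P : {linear Mn -> Mn}) x i j :
  P x i j = \sum_p x p.1 p.2 * P (delta_mx p.1 p.2) i j.
Proof.
rewrite {1}[x]matrix_sum_delta pair_big /= linear_sum summxE.
by apply: eq_bigr => p _; rewrite linearZ mxE.
Qed.

Lemma sum_delta (V : lmodType F) (f : 'I_n * 'I_n -> V) i j :
  \sum_p (delta_mx i j : Mn) p.1 p.2 *: f p = f (i, j).
Proof.
rewrite (bigD1 (i, j)) //= mxE !eqxx scale1r big1 ?addr0 // => -[k l].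
by rewrite mxE xpair_eqE => /negbTE /= ->; rewrite scale0r.
Qed.

End Terms.

(** * Finite sums and maps out of tensor products *)

Section Tensor.
Variables (K : comNzRingType) (A B : lmodType K).
Lemma tlift_sum (V : zmodType) (f : A -> B -> V) (I : Type) (r : seq I) Q
    (F : I -> (A ⊗ B)%type) : balanced f ->
  tlift f (\sum_(i <- r | Q i) F i) = \sum_(i <- r | Q i) tlift f (F i).
Proof.
move=> fb; apply: (big_morph (tlift f)); first exact: tliftD.
apply: (@addrI _ (tlift f 0)).
by rewrite -tliftD // !addr0.
Qed.

Lemma tmap_sum (A' B' : lmodType K) (f : {linear A -> A'}) (g : {linear B -> B'})
    (I : Type) (r : seq I) Q (F : I -> (A ⊗ B)%type) :
  tmap f g (\sum_(i <- r | Q i) F i) = \sum_(i <- r | Q i) tmap f g (F i).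
Proof.
apply: tlift_sum; apply: bilinear_balanced.
have [bl br] := @tpure_bilinear K A' B'.
split=> [b|a] c x y; rewrite /= linearP; [exact: bl|exact: br].
Qed.

End Tensor.

(** * Antipode, trace form and equivariant projections *)

Section Quantum.
Variables (R : realType) (n : nat) (G : cqgAlgebra R).
Local Notation C := R[i].
Local Notation Mn := 'M[C]_n.
Variable alpha : Mn -> 'M[G]_n.
Hypothesis act : is_tau_action alpha.

Let E (k l : 'I_n) : Mn := delta_mx k l.
Let S := antipode G.

Lemma actionD x y : alpha (x + y) = alpha x + alpha y.
Proof.
have := action_linear act 1 x y; rewrite scale1r => ->.
by congr (_ + _); apply/matrixP => i j; rewrite mxE scale1r.
Qed.

Lemma action0 : alpha 0 = 0.
Proof. by apply: (@addrI _ (alpha 0)); rewrite -actionD !addr0. Qed.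

Lemma actionZ c x i j : alpha (c *: x) i j = c *: alpha x i j.
Proof. by have := action_linear act c x 0; rewrite addr0 action0 addr0 => ->; rewrite mxE. Qed.

Lemma action_sum (I : Type) (r : seq I) Q (F : I -> Mn) :
  alpha (\sum_(i <- r | Q i) F i) = \sum_(i <- r | Q i) alpha (F i).
Proof. by apply: (big_morph alpha); [exact: actionD | exact: action0]. Qed.

Lemma action_delta x i j : alpha x i j = \sum_p x p.1 p.2 *: alpha (E p.1 p.2) i j.
Proof.
rewrite {1}[x]matrix_sum_delta pair_big action_sum summxE.
by apply: eq_bigr => p _; rewrite actionZ.
Qed.

Lemma action_counitE x i j : counit G (alpha x i j) = x i j.
Proof. by have /matrixP/(_ i j) := action_counit act x; rewrite !mxE. Qed.

(** Read [alpha (E k l) i j] as the entries of a matrix: by coassociativity, its antipode is a right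
    inverse. *)
Lemma action_antipoder x i j :
  \sum_p alpha (E p.1 p.2) i j * S (alpha x p.1 p.2) = (x i j)%:A.
Proof.
have := antipoder (hopf_starP G) (alpha x i j).
have fb : balanced (fun a b : G => a * antipode G b).
  split=> [a a' b|a b b'|c a b]; rewrite ?mulrDl ?linearD ?mulrDr //.
  by rewrite linearZ /= -scalerAl scalerAr.
have /matrixP/(_ i j) := action_coassoc act x; rewrite !mxE pair_big => -> /=.
rewrite action_counitE => <-.
by rewrite tlift_sum //; apply: eq_bigr => p _; rewrite tlift_tpure.
Qed.

Hypothesis n_gt0 : (0 < n)%N.

(** Multiplicativity and invariance of the trace combine into invariance of the trace form, which
    makes the adjoint of the coefficient matrix a left inverse. *)
Lemma action_trace x y :
  \sum_p alpha x p.1 p.2 * alpha y p.2 p.1 = (\tr (x *m y))%:A.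
Proof.
have := action_tau act (x *m y); rewrite (actionM act) /mxtau /ntr => /(congr1 ( *:%R n%:R)).
rewrite !scalerA mulrA divff ?pnatr_eq0 -?lt0n // mul1r scale1r => <-.
rewrite /mxtrace; under [RHS]eq_bigr => i _ do rewrite mxE.
by rewrite pair_big.
Qed.

(** The slice map: the functional [\tr (x *m _)] on the first leg of [M_n ⊗ G]. *)
Definition pairing (x : Mn) (X : 'M[G]_n) : G := \sum_p x p.1 p.2 *: X p.2 p.1.

Lemma pairing_delta X i j : pairing (E i j) X = X j i.
Proof. by rewrite /pairing (sum_delta (fun p => X p.2 p.1)). Qed.

(* The antipode of the matrix of [alpha] is its inverse, and so is its adjoint *)
(* for the trace form.                                                         *)
Lemma action_antipode x k l : S (alpha x k l) = pairing x (alpha (E l k)).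
Proof.
have step i j : S (alpha (E i j) k l) = alpha (E l k) j i.
  (* A left inverse equals a right inverse: the product of the adjoint, the matrix and its antipode
     is bracketed in two ways. *)
  transitivity (\sum_q alpha (E l k) q.2 q.1 *
      (\sum_p alpha (E p.1 p.2) q.1 q.2 * S (alpha (E i j) p.1 p.2))); last first.
    rewrite -(sum_delta (fun q => alpha (E l k) q.2 q.1)); apply: eq_bigr => q _.
    by rewrite action_antipoder -scalerAr mulr1.
  under [RHS]eq_bigr => q _ do rewrite mulr_sumr.
  rewrite exchange_big -(sum_delta (fun p => S (alpha (E i j) p.1 p.2)) k l).
  apply: eq_bigr => p _; under [RHS]eq_bigr => q _ do rewrite mulrA.
  rewrite -mulr_suml -[LHS]mul1r -scalerAr scalerAl; congr (_ * _).
  transitivity ((\tr (E l k *m E p.1 p.2))%:A : G).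
    by rewrite mxtrace_delta !mxE [k == _]eq_sym [l == _]eq_sym.
  rewrite -action_trace (reindex_inj (h := fun p => (p.2, p.1))) //.
  by apply: inv_inj => -[].
rewrite action_delta /S linear_sum; apply: eq_bigr => p _.
by rewrite linearZ -step.
Qed.

(** The map [P] on the first leg of [M_n ⊗ G]. *)
Definition ext (P : Mn -> Mn) (X : 'M[G]_n) : 'M[G]_n :=
  \matrix_(i, j) \sum_p P (delta_mx p.1 p.2) i j *: X p.1 p.2.

Lemma pairing_ext (P : {linear Mn -> Mn}) x X : trace_symmetric P ->
  pairing (P x) X = pairing x (ext P X).
Proof.
move=> Psym; rewrite /pairing.
under eq_bigr => p _ do rewrite linear_delta scaler_suml.
under [RHS]eq_bigr => p _ do rewrite mxE scaler_sumr.
rewrite exchange_big; apply: eq_bigr => p _.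
rewrite (reindex_inj (h := fun p => (p.2, p.1))); last by apply: inv_inj => -[].
by apply: eq_bigr => q _; rewrite scalerA (trace_symmetric_delta _ _ _ _ Psym).
Qed.

Definition fixed (v : Mn) : Prop := alpha v = map_mx (in_alg G) v.

Lemma ext_scalar (P : {linear Mn -> Mn}) v :
  ext P (map_mx (in_alg G) v) = map_mx (in_alg G) (P v).
Proof.
apply/matrixP => i j; rewrite !mxE /= linear_delta scaler_suml; apply: eq_bigr => p _.
by rewrite mxE /= scalerA mulrC.
Qed.

Section Projection.
Variables (V : {vspace Mn}) (P : {linear Mn -> Mn}) (g : C).
Hypotheses (g_neq0 : g != 0) (P_in : forall x, P x \in V)
  (P_id : forall x, x \in V -> P x = g *: x) (P_sym : trace_symmetric P)
  (V_pres : preserves V alpha).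

(* With [U] the matrix of [alpha], invariance of [V] reads [P U P = g U P]; the *)
(* antipode and then the adjoint for the trace form turn it into               *)
(* [P U P = g P U], whence [P U = U P].                                        *)
Lemma ext_proj x : ext P (alpha (P x)) = map_mx ( *:%R g) (alpha (P x)).
Proof.
have [s [sV ->]] := V_pres (P_in x).
apply/matrixP => i j; rewrite !mxE summxE scaler_sumr.
under eq_bigr => k _ do rewrite summxE scaler_sumr.
rewrite exchange_big big_seq [RHS]big_seq; apply: eq_bigr => p /sV pV /=.
have /matrixP/(_ i j) := P_id pV; rewrite !mxE scalerA => <-.
rewrite linear_delta scaler_suml; apply: eq_bigr => k _.
by rewrite !mxE scalerA mulrC.
Qed.

Lemma action_proj y : alpha (P y) = ext P (alpha y).
Proof.
have pairingZ x X : pairing x (map_mx ( *:%R g) X) = g *: pairing x X.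
  rewrite /pairing scaler_sumr; apply: eq_bigr => p _.
  by rewrite mxE !scalerA mulrC.
(* The relation [P U P = g P U]. *)
have ext_alphaP i j : ext P (alpha (P (E j i))) = map_mx ( *:%R g) (ext P (alpha (E j i))).
  apply/matrixP => k l; rewrite -[LHS]pairing_delta -[RHS]pairing_delta pairingZ.
  (* Pairings with [alpha] of a matrix unit are antipodes of coefficients, so the goal is the image
     under [S] of [ext_proj] at [E l k]. *)
  rewrite -!pairing_ext // -action_antipode.
  have /matrixP/(_ i j) := ext_proj (E l k); rewrite !mxE => /(congr1 S).
  rewrite /S linearZ => /= <-; rewrite linear_sum.
  transitivity (\sum_p P (E p.1 p.2) i j *: pairing (P (E l k)) (alpha (E p.2 p.1))).
    rewrite /pairing.
    under [RHS]eq_bigr => p _ do rewrite scaler_sumr.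
    rewrite exchange_big; apply: eq_bigr => q _ /=.
    rewrite action_delta scaler_sumr (reindex_inj (h := fun p => (p.2, p.1))) /=.
      apply: eq_bigr => p _.
      by rewrite !scalerA mulrC (trace_symmetric_delta _ _ _ _ P_sym).
    by apply: inv_inj => -[].
  by apply: eq_bigr => p _; rewrite linearZ -action_antipode.
(* Multiplied by [g], both sides become [ext P (alpha (P y))]. *)
apply/matrixP => k l; apply: (scalerI g_neq0).
have /matrixP/(_ k l) := ext_proj y; rewrite !mxE => <-.
rewrite [X in alpha (P X)]matrix_sum_delta pair_big linear_sum action_sum.
rewrite scaler_sumr.
under eq_bigr => p _ do rewrite summxE scaler_sumr.
under [RHS]eq_bigr => p _ do rewrite action_delta !scaler_sumr.
rewrite exchange_big [RHS]exchange_big; apply: eq_bigr => p _ /=.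
have /matrixP/(_ k l) := ext_alphaP p.2 p.1; rewrite !mxE scaler_sumr => eP.
transitivity (y p.1 p.2 *: \sum_q P (delta_mx q.1 q.2) k l *: alpha (P (E p.1 p.2)) q.1 q.2).
  rewrite scaler_sumr; apply: eq_bigr => q _.
  by rewrite linearZ actionZ !scalerA mulrC.
rewrite eP scaler_sumr; apply: eq_bigr => q _.
by rewrite !scalerA -!mulrA; congr (_ *: _); rewrite mulrC -mulrA.
Qed.
End Projection.

(** The tensor [\sum_p E p.1 p.2 ⊗ E p.2 p.1], dual to the trace form, is invariant by the antipode
    relations; [P] may be applied to its first leg since it commutes with the action. *)
Lemma fixed_sandwich (P : {linear Mn -> Mn}) v :
  (forall y, alpha (P y) = ext P (alpha y)) -> fixed v -> fixed (sandwich P v).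
Proof.
move=> aP fv; rewrite /fixed.
have delta_swap (p : 'I_n * 'I_n) a j : E p.2 p.1 a j = E j a p.1 p.2.
  by rewrite !mxE andbC [a == _]eq_sym [j == _]eq_sym.
have {1}-> : sandwich P v = \sum_p P (E p.1 p.2) *m v *m E p.2 p.1.
  apply/matrixP => i j; rewrite mxE summxE exchange_big.
  under [RHS]eq_bigr => p _ do rewrite mxE.
  rewrite [RHS]exchange_big; apply: eq_bigr => a _ /=.
  rewrite -[LHS]/(\sum_b P (E j a) i b * v b a).
  transitivity ((P (E j a) *m v) i a); first by rewrite mxE.
  rewrite -(sum_delta (fun p => (P (E p.1 p.2) *m v) i a : C^o)).
  by apply: eq_bigr => p _; rewrite mulrC delta_swap.
rewrite action_sum; apply/matrixP => i j; rewrite summxE mxE.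
transitivity (\sum_a \sum_b \sum_r (P (E r.1 r.2) i b * v b a) *:
    (\sum_p alpha (E p.1 p.2) r.1 r.2 * alpha (E p.2 p.1) a j)).
  under eq_bigr => p _ do rewrite !(actionM act) aP fv mxE.
  rewrite exchange_big; apply: eq_bigr => a _.
  under eq_bigr => p _ do rewrite mxE mulr_suml.
  rewrite exchange_big; apply: eq_bigr => b _.
  under [RHS]eq_bigr => r _ do rewrite scaler_sumr.
  rewrite exchange_big; apply: eq_bigr => p _.
  rewrite !mxE !mulr_suml; apply: eq_bigr => r _.
  by rewrite /= -scalerAl -scalerAr mulr1 scalerA -scalerAl mulrC.
rewrite mxE exchange_big /= scaler_suml; apply: eq_bigr => b _.
rewrite scaler_suml; apply: eq_bigr => a _.
rewrite -(sum_delta (fun r => (P (E r.1 r.2) i b * v b a)%:A : G)).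
apply: eq_bigr => r _; rewrite scalerA [X in _ = X *: _]mulrC -[RHS]scalerA; congr (_ *: _).
rewrite -action_antipoder; apply: eq_bigr => p _; congr (_ * _).
by rewrite action_antipode pairing_delta.
Qed.

Lemma fixed_term_eval (P : {linear Mn -> Mn}) t :
  (forall y, alpha (P y) = ext P (alpha y)) -> fixed (term_eval P t).
Proof.
move=> aP; elim: t => [|t ft u fu|c t ft|t ft u fu|t ft|t ft] /=.
- by rewrite /fixed (action1 act) map_mx1.
- by rewrite /fixed actionD ft fu map_mxD.
- apply/matrixP => i j; rewrite actionZ ft !mxE.
  by rewrite scalerA.
- by rewrite /fixed (actionM act) ft fu map_mxM.
- by rewrite /fixed aP ft ext_scalar.
- exact: fixed_sandwich.
Qed.

End Quantum.

(** * From trivial actions to the trivial quantum group *)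

Section TrivialAction.
Variables (R : realType) (n : nat).
Hypothesis n_gt0 : (0 < n)%N.
Local Notation C := R[i].
Local Notation Mn := 'M[C]_n.

Section Pushforward.
Variables (G K : cqgAlgebra R) (q : {lrmorphism G -> K}) (alpha : Mn -> 'M[G]_n).
Hypotheses (qP : is_cqg_morphism q) (act : is_tau_action alpha).

Lemma restrict_tau_action : is_tau_action (restrict_action q alpha).
Proof.
have [q_star q_comul q_counit] := qP.
split=> [c x y||x y|x|x|x|x]; rewrite /restrict_action.
- rewrite (action_linear act) map_mxD; congr (_ + _).
  by apply/matrixP => i j; rewrite !mxE /= linearZ.
- by rewrite (action1 act) map_mx1.
- by rewrite (actionM act) map_mxM.
- rewrite (action_star act); apply/matrixP => i j.
  by rewrite !mxE q_star.
- apply/matrixP => i j; rewrite !mxE q_comul.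
  have /matrixP/(_ i j) := action_coassoc act x; rewrite !mxE => ->.
  rewrite tmap_sum; apply: eq_bigr => k _; rewrite tmap_sum; apply: eq_bigr => l _.
  by rewrite tmapE !mxE.
- apply/matrixP => i j; rewrite !mxE q_counit.
  by have /matrixP/(_ i j) := action_counit act x; rewrite !mxE.
- rewrite /mxtau trace_map_mx -linearZ /=.
  by have := action_tau act x; rewrite /mxtau => ->; rewrite linearZ /= rmorph1.
Qed.
End Pushforward.

Lemma star1 (G : cqgAlgebra R) : star (1 : G) = 1.
Proof.
have H := hopf_starP G.
by rewrite -[LHS]mul1r -{1}(starK H 1) -(starM H) mul1r (starK H).
Qed.

Section CQGFacts.
Variables G K : cqgAlgebra R.

Lemma tpureZ (A B : lmodType C) c d (a : A) (b : B) :
  (c *: a) ⊗ (d *: b) = (c * d) *: (a ⊗ b).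
Proof.
have [bl br] := @tpure_bilinear C A B.
have e1 : (c *: a) ⊗ (d *: b) = c *: (a ⊗ (d *: b)) by exact: (scalable_linear (bl _)).
have e2 : a ⊗ (d *: b) = d *: (a ⊗ b) by exact: (scalable_linear (br _)).
by rewrite e1 e2 scalerA.
Qed.

(** Dually, the homomorphism between quantum groups that factors through the trivial one. *)
Definition counit_unit (a : G) : K := (counit G a)%:A.

Lemma counit_unit_linear : linear counit_unit.
Proof. by move=> c x y; rewrite /counit_unit linearP scalerDl scalerA. Qed.

Lemma counit_unit_multiplicative : monoid_morphism counit_unit.
Proof.
split; first by rewrite /counit_unit rmorph1 scale1r.
by move=> x y; rewrite /counit_unit rmorphM -scalerAl mul1r scalerA.
Qed.

HB.instance Definition _ :=
  GRing.isLinear.Build C G K *:%R counit_unit counit_unit_linear.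
HB.instance Definition _ :=
  GRing.isMonoidMorphism.Build G K counit_unit counit_unit_multiplicative.

Lemma counit_unit_morphism : is_cqg_morphism (counit_unit : {lrmorphism G -> K}).
Proof.
have HG := hopf_starP G; have HK := hopf_starP K.
have counit_bal : balanced (fun x y : G => counit G x *: y).
  split=> [x y z|x y z|c x y]; first by rewrite linearD scalerDl.
    by rewrite scalerDr.
  by rewrite linearZ /= [RHS]scalerA [in RHS]mulrC.
split=> a /=.
- by rewrite /counit_unit (counit_star HG) (starZ HK) star1.
- rewrite [in LHS]/counit_unit linearZ /= (comul1 HK).
  (* The counit law turns [counit a] into the sum of the products of the counits of the two legs of
     [comul a]. *)
  rewrite -{1}(counitl HG a) [comul G a]tensor_sum_pure.
  rewrite tlift_sum // tmap_sum linear_sum scaler_suml.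
  apply: eq_bigr => p _; rewrite tmapE tlift_tpure // linearZ /= /counit_unit.
  by rewrite tpureZ.
- by rewrite /counit_unit linearZ rmorph1 /=; exact: mulr1.
Qed.

End CQGFacts.

(** * The scalars as a CQG algebra *)

Section TrivialCQG.
Local Notation Co := (R[i]^o : algType R[i]).

Definition scalar_comul (c : R[i]^o) : (Co ⊗ Co)%type := c *: (1 ⊗ 1).

Lemma scalar_comul_linear : linear scalar_comul.
Proof. by move=> c x y; rewrite /scalar_comul scalerDl scalerA. Qed.

HB.instance Definition _ :=
  GRing.isLinear.Build C Co (Co ⊗ Co)%type *:%R scalar_comul scalar_comul_linear.

Lemma scalar_hopf_star : @is_hopf_star R Co Num.conj scalar_comul idfun idfun.
Proof.
have sE (c : Co) : scalar_comul c = c ⊗ 1.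
  rewrite /scalar_comul -[1 in RHS](scale1r (1 : Co)) -[c in RHS]mulr1.
  by rewrite -[c * 1 in RHS]/(c *: (1 : Co)) tpureZ mulr1.
have bal : balanced (fun x y : Co => x * y).
  split=> [x y z|x y z|c x y]; rewrite ?mulrDl ?mulrDr //.
  by rewrite -scalerAl scalerAr.
have pure_sum (A B : lmodType C) (a : A) (b b' : B) : a ⊗ (b + b') = a ⊗ b + a ⊗ b'.
  by case: (bilinear_balanced (@tpure_bilinear C A B)).
have sum_pure (A B : lmodType C) (a a' : A) (b : B) : (a + a') ⊗ b = a ⊗ b + a' ⊗ b.
  by case: (bilinear_balanced (@tpure_bilinear C A B)).
have balJ : balanced (fun x y : Co => (Num.conj x : Co) ⊗ (Num.conj y : Co)).
  split=> [x y z|x y z|c x y]; rewrite ?rmorphD ?sum_pure ?pure_sum //.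
  rewrite -[c *: x]/(c * x) -[c *: y]/(c * y) !rmorphM.
  rewrite -[_ * _ : Co in LHS]/(c^* *: (x^* : Co)) -[_ * _ : Co in RHS]/(c^* *: (y^* : Co)).
  by rewrite -[y^* in LHS]scale1r tpureZ -[x^* in RHS]scale1r tpureZ mulrC.
split=> [a b|c a|a b|a||a b|a|a|a|a|a|a|a]; rewrite ?sE.
- exact: rmorphD.
- exact: rmorphM.
- by rewrite rmorphM mulrC.
- exact: conjCK.
- by [].
- by rewrite tmulE mulr1.
- by rewrite /tmap tlift_tpure // rmorph1.
- by [].
- rewrite (tmapE scalar_comul idfun) (tmapE idfun scalar_comul) /= !sE.
  exact: tassocE.
- by rewrite tlift_tpure //; exact: mulr1.
- rewrite tlift_tpure ?scale1r //.
  split=> [x y z|x y z|c x y]; rewrite ?scalerDr ?scalerDl //.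
  by rewrite scalerA mulrC -scalerA.
- by rewrite tlift_tpure.
- by rewrite tlift_tpure.
Qed.

Definition scalar_hopf : hopfStarAlgebra R := HopfStarAlgebra scalar_hopf_star.

Lemma scalar_cqg_span (a : scalar_hopf) : exists s : seq (C * scalar_hopf),
  (forall p, p \in s -> unitary_coefficient p.2) /\ a = \sum_(p <- s) p.1 *: p.2.
Proof.
exists [:: (a : C, 1)]; split=> [p|]; last by rewrite big_seq1 /= -[LHS]mulr1.
rewrite inE => /eqP -> /=; exists 1%N, 1%:M; split.
- split=> i j; rewrite ?big_ord1 !ord1 !mxE //.
  exact: scale1r.
- have e : (1%:M : 'M[scalar_hopf]_1) ^t (@star R scalar_hopf) = 1%:M.
    by apply/matrixP => i j; rewrite !ord1 !mxE; exact: rmorph1.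
  by rewrite /unitary e mulmx1.
- by exists 0, 0; rewrite mxE.
Qed.

Definition scalar_cqg : cqgAlgebra R := CQGAlgebra scalar_cqg_span.

End TrivialCQG.

(** The determinant says that the values of the [t i] form a basis of [M_n], and each of them is
    fixed. The factor [g] allows [P] to be [gram_proj]. *)
Lemma action_fixed (G : cqgAlgebra R) (alpha : Mn -> 'M[G]_n) (V : {vspace Mn})
    (P : {linear Mn -> Mn}) (g : C) (t : 'I_(n * n) -> term R) :
    is_tau_action alpha -> preserves V alpha ->
    g != 0 -> (forall x, P x \in V) -> (forall x, x \in V -> P x = g *: x) ->
    trace_symmetric P ->
    \det (\matrix_(i, j) mxvec (term_eval P (t i)) 0 j) != 0 ->
  forall x, alpha x = map_mx (in_alg G) x.
Proof.
move=> act pres g0 Pin Pid Psym; set M := (\matrix_(i, j) _) => detM x.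
have aP := action_proj act n_gt0 g0 Pin Pid Psym pres.
have uM : M \in unitmx by rewrite unitmxE unitfE.
have -> : x = \sum_i (mxvec x *m invmx M) 0 i *: term_eval P (t i).
  apply: (can_inj mxvecK); rewrite -[LHS](mulmxKV uM) linear_sum.
  apply/rowP => j; rewrite mxE summxE; apply: eq_bigr => i _.
  by rewrite linearZ !mxE.
rewrite (action_sum act); apply/matrixP => i j; rewrite !mxE !summxE /= scaler_suml.
apply: eq_bigr => k _.
by rewrite (actionZ act) (fixed_term_eval act n_gt0 (t k) aP) !mxE /= scalerA.
Qed.

(** Morphisms out of [G] that induce the same action are equal, so a quotient preserving [V] is
    given by the counit and has only scalars in its image. The trivial quantum group is therefore
    the largest such quotient, which settles existence too. *)
Lemma Qut_opsys_trivialP (V : {vspace Mn}) :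
    (forall (G : cqgAlgebra R) (alpha : Mn -> 'M[G]_n),
      is_tau_action alpha -> preserves V alpha ->
      forall x, alpha x = map_mx (in_alg G) x) ->
  Qut_opsys_trivial V.
Proof.
move=> fixV G alpha [act univ].
have scalar_quotient (K : cqgAlgebra R) (q : {lrmorphism G -> K}) :
    is_cqg_morphism q -> preserves V (restrict_action q alpha) ->
    forall a, q a = counit_unit K a.
  move=> qP qV; have qact := restrict_tau_action qP act.
  have [f [fP fE funiq]] := univ K _ qact.
  move=> a; rewrite (funiq q qP) //; symmetry; apply: (funiq (counit_unit K)).
    exact: counit_unit_morphism.
  move=> x; rewrite (fixV _ _ qact qV); apply/matrixP => i j; rewrite !mxE.
  by rewrite /= /counit_unit (action_counitE act).
have trivial_quotient (K : cqgAlgebra R) (q : {lrmorphism G -> K}) :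
    is_quantum_subgroup q -> preserves V (restrict_action q alpha) -> trivial_qgroup K.
  move=> [qP qsurj] qV b; have [a <-] := qsurj b.
  by exists (counit G a); rewrite (scalar_quotient _ _ qP qV).
split; last by move=> H r [rP rV _]; exact: trivial_quotient rP rV.
exists scalar_cqg, (counit_unit scalar_cqg); split.
- split; first exact: counit_unit_morphism.
  move=> c; exists (c%:A); rewrite /= /counit_unit linearZ rmorph1 /= -[RHS]mulr1.
  by congr (_ * _); exact: mulr1.
- move=> x xV; exists [:: (x, 1)]; split=> [p|].
    by rewrite inE => /eqP ->.
  rewrite big_seq1; apply/matrixP => i j; rewrite !mxE /=.
  by rewrite /counit_unit (action_counitE act).
move=> K q [qP _] qV.
exists (counit_unit K); split; first exact: counit_unit_morphism.
move=> a; rewrite (scalar_quotient _ _ qP qV) /= /counit_unit.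
by congr (_ *: _); exact: mulr1.
Qed.

End TrivialAction.

(** * Projections generating the matrix algebra *)

Section Projections.
Variables (R : realType) (n : nat).
Local Notation C := R[i].
Local Notation Mn := 'M[C]_n.

Definition dagger (x : Mn) : Mn := x ^t Num.conj.

Definition generated (P : Mn -> Mn) (v : Mn) : Prop := exists t, term_eval P t = v.

(** Trace of [P] as an operator on [M_n]: for a projection, the dimension of its range, in a form
    that is additive on the summands of the examples. *)
Definition operator_trace (P : Mn -> Mn) : C :=
  \sum_p P (delta_mx p.1 p.2) p.1 p.2.

Record orthogonal_projection (P : Mn -> Mn) : Prop := {
  proj_symmetric : trace_symmetric P;
  proj_idem : forall x, P (P x) = P x;
  proj_dagger : forall x, P (dagger x) = dagger (P x)
}.

Section Generated.
Variable P : Mn -> Mn.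
Lemma generated1 : generated P 1%:M. Proof. by exists (One R). Qed.
Lemma generatedD u v : generated P u -> generated P v -> generated P (u + v).
Proof. by move=> [t <-] [s <-]; exists (Add t s). Qed.
Lemma generatedZ c u : generated P u -> generated P (c *: u).
Proof. by move=> [t <-]; exists (Scale c t). Qed.
Lemma generatedM u v : generated P u -> generated P v -> generated P (u *m v).
Proof. by move=> [t <-] [s <-]; exists (Mul t s). Qed.
Lemma generated_proj u : generated P u -> generated P (P u).
Proof. by move=> [t <-]; exists (Proj t). Qed.
Lemma generated_sandwich u : generated P u -> generated P (sandwich P u).
Proof. by move=> [t <-]; exists (Sandwich t). Qed.
Lemma generatedN u : generated P u -> generated P (- u).
Proof. by rewrite -scaleN1r; exact: generatedZ. Qed.
Lemma generatedB u v : generated P u -> generated P v -> generated P (u - v).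
Proof. by move=> gu /generatedN; exact: generatedD. Qed.
Lemma generated0 : generated P 0.
Proof. by rewrite -(scale0r 1%:M); exact: generatedZ generated1. Qed.
Lemma generated_sum (I : Type) (r : seq I) (Q : pred I) (f : I -> Mn) :
  (forall i, Q i -> generated P (f i)) -> generated P (\sum_(i <- r | Q i) f i).
Proof. by move=> gf; apply: big_ind => //; [exact: generated0|exact: generatedD]. Qed.
End Generated.

Lemma trace_nondegenerate (x y : Mn) :
  (forall b, \tr (x *m b) = \tr (y *m b)) -> x = y.
Proof.
move=> exy; apply/matrixP => i j.
by rewrite -[LHS]mxtrace_delta mxtrace_mulC exy mxtrace_mulC mxtrace_delta.
Qed.

Lemma mulmx_delta (x : Mn) i j : \tr (x *m delta_mx i j) = x j i.
Proof. by rewrite mxtrace_mulC mxtrace_delta. Qed.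

(** For [y] self-adjoint or anti-self-adjoint this is the Hilbert-Schmidt projection on the line of
    [y]: the signs of the two traces cancel. *)
Definition line_proj (y a : Mn) : Mn := (\tr (y *m a) / \tr (y *m y)) *: y.

Lemma line_proj_linear y : linear (line_proj y).
Proof.
move=> c a b; rewrite /line_proj mulmxDr -scalemxAr mxtraceD mxtraceZ mulrDl.
by rewrite scalerDl scalerA mulrA.
Qed.
HB.instance Definition _ y :=
  GRing.isLinear.Build C Mn Mn *:%R (line_proj y) (line_proj_linear y).

Lemma line_proj_symmetric y : trace_symmetric (line_proj y).
Proof.
move=> a b; rewrite /line_proj -scalemxAl -scalemxAr !mxtraceZ.
by rewrite [\tr (a *m y)]mxtrace_mulC mulrAC [RHS]mulrC mulrA.
Qed.

Lemma line_proj_id y : \tr (y *m y) != 0 -> line_proj y y = y.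
Proof. by move=> y0; rewrite /line_proj divff // scale1r. Qed.

Lemma line_proj_eq0 y a : \tr (y *m a) = 0 -> line_proj y a = 0.
Proof. by move=> e; rewrite /line_proj e mul0r scale0r. Qed.

Lemma daggerZ c (x : Mn) : dagger (c *: x) = c^* *: dagger x.
Proof. by apply/matrixP => i j; rewrite !mxE rmorphM. Qed.
Lemma daggerD (x y : Mn) : dagger (x + y) = dagger x + dagger y.
Proof. by apply/matrixP => i j; rewrite !mxE rmorphD. Qed.
Lemma daggerB (x y : Mn) : dagger (x - y) = dagger x - dagger y.
Proof. by apply/matrixP => i j; rewrite !mxE rmorphB. Qed.
Lemma dagger1 : dagger 1%:M = 1%:M :> Mn.
Proof. by apply/matrixP => i j; rewrite !mxE rmorph_nat eq_sym. Qed.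

Lemma trace_dagger (x y : Mn) : (\tr (x *m y))^* = \tr (dagger x *m dagger y).
Proof.
rewrite mxtrace_mulC /dagger -map_mxM -trmx_mul.
by rewrite trace_map_mx mxtrace_tr.
Qed.

Lemma line_proj_dagger y a : dagger y = y \/ dagger y = - y ->
  line_proj y (dagger a) = dagger (line_proj y a).
Proof.
move=> ey; rewrite /line_proj daggerZ rmorphM fmorphV /= !trace_dagger.
by case: ey => ->; rewrite ?mulNmx ?mulmxN ?opprK // (raddfN mxtrace) mulNr scalerN scaleNr opprK.
Qed.

Lemma line_projP y : \tr (y *m y) != 0 -> dagger y = y \/ dagger y = - y ->
  orthogonal_projection (line_proj y).
Proof.
move=> y0 ey; split=> [|a|a]; first exact: line_proj_symmetric.
  by rewrite {2}/line_proj linearZ /= line_proj_id.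
exact: line_proj_dagger.
Qed.

Lemma line_proj_sandwich y v :
  sandwich (line_proj y) v = (\tr (y *m y))^-1 *: (y *m v *m y).
Proof.
apply/matrixP => i j; rewrite !mxE mulr_sumr exchange_big; apply: eq_bigr => q _.
rewrite mxE mulr_suml mulr_sumr; apply: eq_bigr => p _.
rewrite /line_proj mulmx_delta mxE.
by set u := _^-1; ring.
Qed.

Lemma line_proj_trace y : \tr (y *m y) != 0 -> operator_trace (line_proj y) = 1.
Proof.
move=> y0; rewrite /operator_trace -[RHS](divff y0) {2}/mxtrace mulr_suml.
under [RHS]eq_bigr => i _ do rewrite mxE mulr_suml.
rewrite pair_big; apply: eq_bigr => p _ /=.
by rewrite /line_proj mulmx_delta mxE; set u := _^-1; ring.
Qed.

Definition diag_proj (a : Mn) : Mn := \matrix_(i, j) (a i j *+ (i == j)).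

Lemma diag_proj_linear : linear diag_proj.
Proof. by move=> c a b; apply/matrixP => i j; rewrite !mxE mulrnDl mulrnAr. Qed.
HB.instance Definition _ :=
  GRing.isLinear.Build C Mn Mn *:%R diag_proj diag_proj_linear.

Lemma diag_projP : orthogonal_projection diag_proj.
Proof.
split=> [a b|a|a].
- rewrite /mxtrace; apply: eq_bigr => i _; rewrite !mxE.
  rewrite (bigD1 i) //= [RHS](bigD1 i) //= !mxE eqxx.
  congr (_ + _); rewrite !big1 // => j /negbTE ji.
    by rewrite mxE ji mulr0.
  by rewrite mxE [i == j]eq_sym ji mul0r.
- by apply/matrixP => i j; rewrite !mxE; case: eqP.
- apply/matrixP => i j; rewrite !mxE [j == i]eq_sym rmorphMn.
  by case: eqP => //= ->.
Qed.

Lemma diag_proj_trace : operator_trace diag_proj = n%:R.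
Proof.
rewrite /operator_trace -(pair_big xpredT xpredT (fun i j => diag_proj (delta_mx i j) i j)) /=.
rewrite -[RHS]mulr1 mulr_natl -[in RHS](card_ord n) -sumr_const; apply: eq_bigr => i _.
rewrite (bigD1 i) //= !mxE !eqxx big1 ?addr0 // => j /negbTE ji.
by rewrite mxE [i == j]eq_sym ji.
Qed.

(* Orthogonal projection on the span of the [i (E_kl - E_lk)], [Z k l]. *)
Definition edge_proj (Z : rel 'I_n) (a : Mn) : Mn :=
  \matrix_(i, j) (if Z i j then (a i j - a j i) / 2 else 0).

Lemma edge_proj_linear Z : linear (edge_proj Z).
Proof.
move=> c a b; apply/matrixP => i j; rewrite !mxE; case: ifP => _; last by rewrite mulr0 addr0.
by field.
Qed.
HB.instance Definition _ Z :=
  GRing.isLinear.Build C Mn Mn *:%R (edge_proj Z) (edge_proj_linear Z).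

Lemma edge_projP Z : symmetric Z -> orthogonal_projection (edge_proj Z).
Proof.
move=> Zsym; split=> [a b|a|a].
- pose z i j : C := (Z i j)%:R / 2.
  have e1 x i j : edge_proj Z x i j = z i j * (x i j - x j i).
    by rewrite mxE /z; case: (Z i j); [rewrite mul1r mulrC|rewrite !mul0r].
  have zsym i j : z i j = z j i by rewrite /z Zsym.
  transitivity (\sum_i \sum_j z i j * (a i j * b j i) - \sum_i \sum_j z i j * (a j i * b j i)).
    rewrite -sumrB; apply: eq_bigr => i _; rewrite mxE -sumrB; apply: eq_bigr => j _.
    by rewrite e1; ring.
  rewrite [X in _ - X]exchange_big -sumrB; apply: eq_bigr => i _ /=.
  rewrite mxE -sumrB; apply: eq_bigr => j _.
  by rewrite e1 [z j i]zsym; ring.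
- by apply/matrixP => i j; rewrite !mxE [Z j i]Zsym; case: (Z i j) => //; field.
- apply/matrixP => i j; rewrite !mxE [Z j i]Zsym; case: ifP => // _; last by rewrite rmorph0.
  by rewrite rmorphM rmorphB fmorphV rmorph_nat.
Qed.

Lemma edge_proj_trace Z : irreflexive Z ->
  operator_trace (edge_proj Z) = #|[pred p | Z p.1 p.2]|%:R / 2.
Proof.
move=> Zirr; rewrite -sum1_card natr_sum mulr_suml [RHS]big_mkcond.
apply: eq_bigr => -[i j] _ /=; rewrite mxE inE; case: ifP => // Zij.
rewrite !mxE !eqxx /=; case: eqP => [eij|]; last by rewrite subr0.
by rewrite eij Zirr in Zij.
Qed.

End Projections.

(** * A diagonal part, edges and one weighted line *)

Section Example.
Variables (R : realType) (n : nat).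
Local Notation C := R[i].
Local Notation Mn := 'M[C]_n.

Definition diagonal (a : Mn) := forall i j, i != j -> a i j = 0.

Lemma diagonalE a : diagonal a -> a = \sum_i a i i *: delta_mx i i.
Proof.
move=> ad; apply/matrixP => i j; rewrite summxE (bigD1 i) //= !mxE eqxx.
rewrite big1 ?addr0 => [|k /negbTE ki]; last by rewrite !mxE [i == k]eq_sym ki mulr0.
have [->|ij] := eqVneq i j; first by rewrite mulr1.
by rewrite mulr0 ad.
Qed.

Lemma mxtrace_diagonal x a : diagonal a -> \tr (x *m a) = \sum_i x i i * a i i.
Proof.
move=> ad; apply: eq_bigr => i _; rewrite mxE (bigD1 i) //= big1 ?addr0 // => j ji.
by rewrite ad ?mulr0.
Qed.

(** Lagrange interpolation: the normalized product of the [d - d j j *: 1] over [j != i] is the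
    matrix unit at [(i, i)]. *)
Lemma generated_diagonal P (d : Mn) : diagonal d ->
  (forall i j, i != j -> d i i != d j j) -> generated P d ->
  forall a, diagonal a -> generated P a.
Proof.
move=> dd dist gd.
suff gE i : generated P (delta_mx i i).
  move=> a /diagonalE ->; apply: generated_sum => i _; exact: generatedZ.
have separate (s : seq 'I_n) : i \notin s ->
    exists u, [/\ generated P u, diagonal u, u i i = 1 & forall j, j \in s -> u j j = 0].
  elim: s => [|j s IH] /=.
    move=> _; exists 1%:M; split=> // [|k l /negbTE kl|]; first exact: generated1.
      by rewrite mxE kl.
    by rewrite mxE eqxx.
  rewrite inE negb_or => /andP[ij /IH [u [gu du ui us]]].
  pose c := (d i i - d j j)^-1; exists (c *: (u *m (d - d j j *: 1%:M))).
  have ddj : diagonal (d - d j j *: 1%:M).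
    by move=> k l kl; rewrite !mxE (dd _ _ kl) (negbTE kl) mulr0 subr0.
  have umE k l : (u *m (d - d j j *: 1%:M)) k l = u k k * (d - d j j *: 1%:M) k l.
    rewrite mxE (bigD1 k) //= big1 ?addr0 // => m mk.
    by rewrite du ?mul0r // eq_sym.
  split.
  - apply/generatedZ/generatedM => //; apply: generatedB => //.
    exact/generatedZ/generated1.
  - by move=> k l kl; rewrite mxE umE ddj // !mulr0.
  - rewrite mxE umE ui !mxE eqxx mul1r mulr1 mulVf // subr_eq0; exact: dist.
  - move=> k; rewrite inE mxE umE => /orP[/eqP ->|ks]; last by rewrite us // mul0r mulr0.
    by rewrite !mxE eqxx mulr1 subrr !mulr0.
have [|u [gu du ui us]] := separate [seq j <- enum 'I_n | j != i].
  by rewrite mem_filter eqxx.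
suff <- : u = delta_mx i i by [].
apply/matrixP => k l; rewrite mxE; have [->|kl] := eqVneq k l; last first.
  by rewrite du //; case: eqP => //= <-; rewrite eq_sym (negbTE kl).
have [->|li] := eqVneq l i; first by rewrite ui.
by rewrite us // mem_filter li mem_enum.
Qed.

Variables (PA : {linear Mn -> Mn}) (Z : rel 'I_n) (s : C) (K : Mn).
Hypotheses (PA_proj : orthogonal_projection PA) (PA_diag : forall a, diagonal (PA a))
  (PA1 : PA 1%:M = 1%:M) (Z_sym : symmetric Z) (Z_irr : irreflexive Z)
  (K_tr : K^T = - K) (K_dagger : dagger K = - K) (K_neq0 : \tr (K *m K) != 0)
  (s_neq0 : s != 0)
  (Z_K : (s = 1 /\ edge_proj Z K = 0) \/ (s = -1 /\ edge_proj Z K = K)).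

(* The line of [i K], where [K] is a weighted graph, is added to ([s = 1]) or  *)
(* removed from ([s = -1]) the span of the edges [Z].                          *)
Definition example_proj (a : Mn) : Mn := PA a + edge_proj Z a + s *: line_proj K a.

Lemma example_proj_linear : linear example_proj.
Proof.
move=> c a b; rewrite /example_proj (linearP PA) (linearP (edge_proj Z)).
by rewrite (linearP (line_proj K)); apply/matrixP => i j; rewrite !mxE; ring.
Qed.
HB.instance Definition _ :=
  GRing.isLinear.Build C Mn Mn *:%R example_proj example_proj_linear.

Lemma example_projE a i j :
  example_proj a i j = PA a i j + edge_proj Z a i j + s * line_proj K a i j.
Proof. by rewrite /example_proj mxE [X in X + _]mxE [X in _ + X]mxE. Qed.

Let K_diag i : K i i = 0.
Proof.
have /matrixP/(_ i i) := K_tr; rewrite !mxE => /eqP.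
by rewrite -subr_eq0 opprK -mulr2n mulrn_eq0 /= => /eqP.
Qed.

(** By symmetry [PA] kills whatever is orthogonal to its range, and its range is diagonal. *)
Lemma PA_offdiag (x : Mn) : (forall i, x i i = 0) -> PA x = 0.
Proof.
move=> x0; apply: trace_nondegenerate => b.
rewrite (proj_symmetric PA_proj) mul0mx mxtrace0 mxtrace_diagonal; last exact: PA_diag.
by apply: big1 => i _; rewrite x0 mul0r.
Qed.

Lemma edge_offdiag (x : Mn) i : edge_proj Z x i i = 0.
Proof. by rewrite mxE Z_irr. Qed.

Lemma edge_symmetric (x : Mn) : x^T = x -> edge_proj Z x = 0.
Proof.
move=> xs; apply/matrixP => i j; rewrite !mxE -{2}xs mxE subrr mul0r.
by case: ifP.
Qed.

Lemma diagonal_tr (a : Mn) : diagonal a -> a^T = a.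
Proof.
move=> ad; apply/matrixP => i j; rewrite mxE; have [->//|ij] := eqVneq i j.
by rewrite !ad // eq_sym.
Qed.

Lemma trace_K_symmetric (x : Mn) : x^T = x -> \tr (K *m x) = 0.
Proof.
move=> xs; have := mxtrace_tr (K *m x).
rewrite trmx_mul xs K_tr mulmxN (raddfN mxtrace) mxtrace_mulC => /eqP.
by rewrite eq_sym -subr_eq0 opprK -mulr2n mulrn_eq0 /= => /eqP.
Qed.

Lemma line_K_symmetric (x : Mn) : x^T = x -> line_proj K x = 0.
Proof. by move=> xs; apply/line_proj_eq0/trace_K_symmetric. Qed.

Lemma example_proj_symmetric (x : Mn) : x^T = x -> example_proj x = PA x.
Proof.
by move=> xs; rewrite /example_proj edge_symmetric // line_K_symmetric // scaler0 !addr0.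
Qed.

Lemma example_projP : orthogonal_projection example_proj.
Proof.
have [edge_sym edge_idem edge_dagger] := edge_projP R Z_sym.
have [|line_sym line_idem line_dagger] := line_projP K_neq0; first by right.
split=> [a b|a|a].
- rewrite /example_proj !mulmxDl !mulmxDr !mxtraceD (proj_symmetric PA_proj) edge_sym.
  by rewrite -scalemxAl -scalemxAr !mxtraceZ line_sym.
- have eK x : line_proj K (edge_proj Z x) = (\tr (edge_proj Z K *m x) / \tr (K *m K)) *: K.
    by rewrite /line_proj -edge_sym.
  have lE x : edge_proj Z (line_proj K x) = (\tr (K *m x) / \tr (K *m K)) *: edge_proj Z K.
    by rewrite /line_proj linearZ.
  rewrite /example_proj !linearD /= [PA (s *: _)]linearZ [edge_proj Z (s *: _)]linearZ.
  rewrite [line_proj K (s *: _)]linearZ /= (proj_idem PA_proj) edge_idem line_idem.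
  rewrite [PA (edge_proj _ _)]PA_offdiag; last exact: edge_offdiag.
  rewrite [PA (line_proj _ _)]PA_offdiag => [|i]; last by rewrite !mxE K_diag mulr0.
  have PAs : (PA a)^T = PA a by apply: diagonal_tr; exact: PA_diag.
  rewrite (edge_symmetric PAs) (line_K_symmetric PAs) eK lE.
  have simp := (mul0mx, mxtrace0, mul0r, scale0r, scaler0, scale1r, addr0, add0r).
  (* Either [K] is orthogonal to the edges and the cross terms vanish, or it lies in their span and
     they cancel against the square of [s]. *)
  case: Z_K => -[-> ->]; rewrite !simp //.
  by rewrite -/(line_proj K a) !scaleN1r opprK addNr addr0 addrA.
- rewrite /example_proj (proj_dagger PA_proj) edge_dagger line_dagger !daggerD daggerZ.
  by case: Z_K => -[-> _]; rewrite ?rmorphN rmorph1.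
Qed.

Lemma example_proj1 : example_proj 1%:M = 1%:M.
Proof.
by rewrite example_proj_symmetric ?trmx1.
Qed.

Lemma example_proj_trace : operator_trace example_proj =
  operator_trace PA + #|[pred p | Z p.1 p.2]|%:R / 2 + s.
Proof.
rewrite -(edge_proj_trace R Z_irr) -[s in RHS]mulr1 -(line_proj_trace K_neq0).
by rewrite mulr_sumr -!big_split; apply: eq_bigr => p _; rewrite /= example_projE.
Qed.

Lemma example_sandwich v : sandwich example_proj v =
  sandwich PA v + sandwich (edge_proj Z) v + (s / \tr (K *m K)) *: (K *m v *m K).
Proof.
rewrite -scalerA -line_proj_sandwich; apply/matrixP => i j; rewrite !mxE.
rewrite mulr_sumr -!big_split; apply: eq_bigr => p _.
rewrite /= mulr_sumr -!big_split; apply: eq_bigr => q _ /=.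
by rewrite example_projE !mulrDl mulrA.
Qed.

Lemma PA_sandwich v i j : diagonal v ->
  sandwich PA v i j = (PA (delta_mx i i) i i * v i i) *+ (i == j).
Proof.
move=> vd; rewrite mxE (bigD1 i) //= [X in _ + X]big1 ?addr0 => [|p pi]; last first.
  by apply: big1 => q _; rewrite PA_diag ?mul0r // eq_sym.
rewrite (bigD1 i) //= big1 ?addr0 => [|q qi]; last by rewrite vd ?mulr0 // eq_sym.
case: eqP => [->//|/eqP ij]; rewrite PA_offdiag ?mxE ?mul0r // => k.
rewrite mxE; case: eqP => //= ->.
by rewrite [j == i]eq_sym (negbTE ij).
Qed.

Lemma edge_sandwich v i j : diagonal v ->
  sandwich (edge_proj Z) v i j = ((\sum_(p | Z i p) v p p) / 2) *+ (i == j).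
Proof.
move=> vd; rewrite mxE mulr_suml -sumrMnl [RHS]big_mkcond; apply: eq_bigr => p _.
rewrite (bigD1 p) //= big1 ?addr0 => [|q qp]; last by rewrite vd ?mulr0 // eq_sym.
rewrite !mxE; case: ifP => [Zip|_]; last by rewrite mul0r.
have ip : i != p by apply: contraTneq Zip => ->; rewrite Z_irr.
rewrite eqxx andbT (negbTE ip) andbF subr0.
by case: (i == j); rewrite ?mulr1n ?mulr0n ?mul0r // mulrC mul1r.
Qed.

Lemma sandwich_diagonal v : diagonal v ->
  diagonal (sandwich PA v + sandwich (edge_proj Z) v).
Proof.
by move=> vd i j /negbTE ij; rewrite mxE PA_sandwich // edge_sandwich // ij addr0.
Qed.

(** [K *m K] need not be diagonal, but its symmetry suffices: on symmetric matrices [example_proj]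
    is [PA], whose values are diagonal. *)
Lemma example_sandwich1_sym : (sandwich example_proj 1%:M)^T = sandwich example_proj 1%:M.
Proof.
have d1 : diagonal 1%:M by move=> i j /negbTE ij; rewrite mxE ij.
rewrite example_sandwich raddfD /= (diagonal_tr (sandwich_diagonal d1)).
by rewrite linearZ /= mulmx1 trmx_mul K_tr mulmxN mulNmx opprK.
Qed.

Lemma example_sandwich1_diag i : sandwich example_proj 1%:M i i =
  PA (delta_mx i i) i i + (\sum_(p | Z i p) 1) / 2 + s * ((K *m K) i i / \tr (K *m K)).
Proof.
have d1 : diagonal 1%:M by move=> k j /negbTE kj; rewrite mxE kj.
rewrite example_sandwich mxE [X in X + _]mxE PA_sandwich // edge_sandwich // eqxx.
rewrite !mxE eqxx mulr1.
rewrite mulmx1 -mulrA [_^-1 * _]mulrC; congr (_ + _ / _ + _).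
  by apply: eq_bigr => p _; rewrite mxE eqxx.
Qed.

Hypothesis distinct : forall i j, i != j ->
  PA (sandwich example_proj 1%:M) i i != PA (sandwich example_proj 1%:M) j j.

Lemma example_generated_diagonal a : diagonal a -> generated example_proj a.
Proof.
apply: (generated_diagonal (d := PA (sandwich example_proj 1%:M))) => //.
have := generated_proj (generated_sandwich (generated1 example_proj)).
by rewrite (example_proj_symmetric example_sandwich1_sym).
Qed.

Lemma example_generated_delta i j k : K i k != 0 -> K k j != 0 ->
  generated example_proj (delta_mx i j).
Proof.
move=> Kik Kkj.
have gE l : generated example_proj (delta_mx l l).
  apply: example_generated_diagonal => p q pq; rewrite mxE; case: eqP => //= <-.
  by rewrite [q == p]eq_sym (negbTE pq).
have dk : diagonal (delta_mx k k).
  move=> p q pq; rewrite mxE; case: eqP => //= <-.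
  by rewrite [q == p]eq_sym (negbTE pq).
have gKEK : generated example_proj (K *m delta_mx k k *m K).
  have c0 : s / \tr (K *m K) != 0 by rewrite mulf_neq0 // invr_eq0.
  (* In the sandwich of [delta_mx k k], the contributions of [PA] and of the edges are diagonal,
     hence already generated; subtracting them leaves a multiple of [K *m delta_mx k k *m K]. *)
  have := generatedZ (s / \tr (K *m K))^-1 (generatedB (generated_sandwich (gE k))
    (example_generated_diagonal (sandwich_diagonal dk))).
  by rewrite example_sandwich [X in _ *: X]addrC addKr scalerA mulVf // scale1r.
have := generatedZ (K i k * K k j)^-1 (generatedM (generatedM (gE i) gKEK) (gE j)).
congr generated; apply/matrixP => p q; rewrite mxE.
have -> : (delta_mx i i *m (K *m delta_mx k k *m K) *m delta_mx j j) p q =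
    (p == i)%:R * (K i k * K k j) * (q == j)%:R.
  rewrite mxE (bigD1 j) //= big1 ?addr0 => [|l /negbTE lj]; last first.
    by rewrite [delta_mx j j _ _]mxE lj mulr0.
  rewrite [delta_mx j j _ _]mxE eqxx /=; congr (_ * _).
  rewrite mxE (bigD1 i) //= big1 ?addr0 => [|l /negbTE li]; last by rewrite mxE li andbF mul0r.
  rewrite mxE eqxx andbT; congr (_ * _).
  rewrite mxE (bigD1 k) //= big1 ?addr0 => [|l /negbTE lk].
    congr (_ * _); rewrite mxE (bigD1 k) //= big1 ?addr0 => [|l /negbTE lk].
      by rewrite mxE !eqxx mulr1.
    by rewrite mxE lk mulr0.
  rewrite mxE big1 ?mul0r // => m _.
  by rewrite mxE lk andbF mulr0.
have c0 : K i k * K k j != 0 by rewrite mulf_neq0.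
rewrite [_ * (_ * _ * _)](_ : _ = (p == i)%:R * (q == j)%:R); last by field; apply/andP.
rewrite mxE.
by case: (p == i); case: (q == j); rewrite /= ?mulr1 ?mulr0 ?mul1r.
Qed.

End Example.

(** * The weighted graph and its degrees *)

Section Weights.
Variable n : nat.
Hypothesis n_ge3 : (3 <= n)%N.

(* Star at [0] with pairwise distinct weights, together with the edge [1 -- 2] *)
(* that makes the graph non-bipartite.                                         *)
Definition weight (i j : nat) : nat :=
  if (i < j)%N then if i == 0%N then j.+1 else ((i == 1) && (j == 2))%N else 0%N.

(** Up to sign, the diagonal entry at [i] of the square of the antisymmetric matrix with these
    weights. *)
Definition degree (i : 'I_n) : nat := (\sum_(j < n) (weight i j ^ 2 + weight j i ^ 2))%N.

Let o0 : 'I_n := Ordinal (leq_trans (isT : (0 < 3)%N) n_ge3).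
Let o1 : 'I_n := Ordinal (leq_trans (isT : (1 < 3)%N) n_ge3).
Let o2 : 'I_n := Ordinal (leq_trans (isT : (2 < 3)%N) n_ge3).

Definition center_degree : nat := (\sum_(j < n | j != o0) j.+1 ^ 2)%N.

Lemma degree_center : degree o0 = center_degree.
Proof.
rewrite /degree /center_degree [RHS]big_mkcond; apply: eq_bigr => j _.
by rewrite /weight -val_eqE /=; case: (val j) => // k; rewrite !addn0.
Qed.

Lemma degree_leaf (i : 'I_n) : i != o0 -> degree i = (i.+1 ^ 2 + (i <= 2))%N.
Proof.
rewrite -val_eqE /= => i0; rewrite /degree (bigD1 o0) //= /weight /= lt0n i0 /= add0n.
congr (_ + _)%N.
have e (o : 'I_n) : o != o0 -> (\sum_(j < n | j != o0) (j == o))%N = 1%N.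
  move=> oo; rewrite (bigD1 o) //= eqxx big1 ?addn0 // => j /andP[_ /negbTE ->] //.
transitivity ((\sum_(j < n | j != o0) (i == o1) * (j == o2)) +
   \sum_(j < n | j != o0) (i == o2) * (j == o1))%N.
  rewrite -big_split; apply: eq_bigr => j; rewrite -!val_eqE /= => j0.
  move: (val i) (val j) i0 j0 => a b.
  by case: a => [|[|[|a]]] // _; case: b => [|[|[|b]]] // _; case: ifP; case: ifP.
rewrite -!big_distrr /= !e // !muln1 -!val_eqE /=.
by move: (val i) i0 => [|[|[|a]]].
Qed.

(** Every squared weight counts at both ends of its edge; the successor is the edge [1 -- 2]. *)
Lemma sum_degree : (\sum_i degree i = 2 * center_degree.+1)%N.
Proof.
rewrite (bigD1 o0) //= degree_center.
under eq_bigr => i i0 do rewrite (degree_leaf i0).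
rewrite big_split /= -/center_degree (bigD1 o1) //= (bigD1 o2) //= big1; first lia.
by move=> i /andP[/andP[]]; rewrite -!val_eqE /=; lia.
Qed.

(** Another leaf [k] contributes at least [4] to the center, more than the edge [1 -- 2] adds to
    [i]. This is why the star has weights [j.+1]: with weights [j] and [n = 3], the center and the
    vertex [2] would both have degree [5]. *)
Lemma degree_leaf_lt (i : 'I_n) : i != o0 -> (degree i < center_degree)%N.
Proof.
move=> i0; rewrite degree_leaf //.
have [k [k0 ki]] : exists k : 'I_n, k != o0 /\ k != i.
  by have [->|i1] := eqVneq i o1; [exists o2|exists o1; split=> //; rewrite eq_sym].
rewrite /center_degree (bigD1 i) //= (bigD1 k) /= ?k0 //.
by move: k0; rewrite -!val_eqE /=; case: (i <= 2)%N; nia.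
Qed.

Lemma degree_inj (i j : 'I_n) : i != j -> degree i != degree j.
Proof.
have [->|i0] := eqVneq i o0; have [->|j0] := eqVneq j o0; rewrite ?eqxx //.
- by move=> _; rewrite degree_center gtn_eqF // degree_leaf_lt.
- by move=> _; rewrite degree_center ltn_eqF // degree_leaf_lt.
rewrite !degree_leaf // -val_eqE /=.
case: (leqP i 2); case: (leqP j 2) => /=; nia.
Qed.

Lemma degree_le (i : 'I_n) : (degree i <= center_degree)%N.
Proof.
by have [->|i0] := eqVneq i o0; [rewrite degree_center|exact/ltnW/degree_leaf_lt].
Qed.

End Weights.

(** * Two families of generating projections *)

Section Instances.
Variables (R : realType) (n : nat).
Hypothesis n_ge3 : (3 <= n)%N.
Local Notation C := R[i].
Local Notation Mn := 'M[C]_n.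

Let o0 : 'I_n := Ordinal (leq_trans (isT : (0 < 3)%N) n_ge3).
Let o1 : 'I_n := Ordinal (leq_trans (isT : (1 < 3)%N) n_ge3).
Let o2 : 'I_n := Ordinal (leq_trans (isT : (2 < 3)%N) n_ge3).

(** The factor [i] that would make it self-adjoint is dropped: it changes neither the complex line
    nor the projection on it. *)
Definition weight_mx : Mn := \matrix_(i, j) ((weight i j)%:R - (weight j i)%:R).
Local Notation K := weight_mx.

Lemma weight_mx_tr : K^T = - K.
Proof. by apply/matrixP => i j; rewrite !mxE opprB. Qed.

Lemma weight_mx_dagger : dagger K = - K.
Proof. by apply/matrixP => i j; rewrite !mxE rmorphB !rmorph_nat opprB. Qed.

Lemma weight_mul0 i j : (weight i j * weight j i = 0)%N.
Proof. by rewrite /weight; case: ltngtP; rewrite ?muln0 ?mul0n. Qed.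

Lemma weight_mx_sqr i : (K *m K) i i = - (degree i)%:R.
Proof.
rewrite mxE /degree natr_sum -sumrN; apply: eq_bigr => j _; rewrite !mxE.
have /(congr1 (fun k => k%:R : C)) := weight_mul0 i j; rewrite natrM natrD !natrX => e.
by ring: e.
Qed.

Lemma weight_mx_trace : \tr (K *m K) = - (2 * (center_degree n_ge3).+1)%:R.
Proof.
rewrite -sum_degree natr_sum -sumrN; apply: eq_bigr => i _.
exact: weight_mx_sqr.
Qed.

Lemma weight_mx_trace_neq0 : \tr (K *m K) != 0.
Proof. by rewrite weight_mx_trace oppr_eq0 pnatr_eq0. Qed.

Lemma weight_mx_star (i : 'I_n) : i != o0 -> K o0 i != 0.
Proof.
rewrite -val_eqE /= => i0; rewrite mxE /weight /= lt0n i0 subr0.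
by rewrite pnatr_eq0.
Qed.

Lemma weight_mx_sym_neq0 i j : K i j != 0 -> K j i != 0.
Proof. by rewrite [X in _ -> X != 0](_ : _ = - K i j) ?oppr_eq0 // !mxE opprB. Qed.

Lemma weight_mx12 : K o1 o2 != 0.
Proof. by rewrite mxE /weight /= subr0 oner_neq0. Qed.

(* The first summands are half-integers and the second ones differ by less     *)
(* than [1/2].                                                                 *)
Lemma degree_shift_inj (s : C) (m : 'I_n -> nat) i j : s = 1 \/ s = -1 -> i != j ->
  (m i)%:R / 2 + s * ((K *m K) i i / \tr (K *m K)) !=
  (m j)%:R / 2 + s * ((K *m K) j j / \tr (K *m K)).
Proof.
move=> s1 ij; have dij := degree_inj n_ge3 ij.
have di := degree_le n_ge3 i; have dj := degree_le n_ge3 j.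
rewrite !weight_mx_sqr weight_mx_trace natrM; set T := center_degree _ in di dj *.
have red (t a b : C) : t != 0 -> a / 2 + s * (- b / - (2 * t)) = (a * t + s * b) / (2 * t).
  by move=> t0; field.
rewrite !red ?pnatr_eq0 // (inj_eq (mulIf _)) ?invr_eq0 ?mulf_neq0 ?pnatr_eq0 //.
(* Over the common denominator [2 * T.+1], the degrees are recovered as remainders modulo [T.+1],
   being at most [T]. *)
have mod_inj a b c e : (b <= T)%N -> (e <= T)%N ->
    (a * T.+1 + b = c * T.+1 + e)%N -> b = e.
  by move=> bT eT /(congr1 (modn^~ T.+1)); rewrite !modnMDl !modn_small.
case: s1 => ->; rewrite ?mul1r ?mulN1r.
  rewrite -!natrM -!natrD eqr_nat; apply: contraNneq dij => e.
  by rewrite (mod_inj _ _ _ _ di dj e).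
rewrite subr_eq addrAC eq_sym subr_eq -!natrM -!natrD eqr_nat; apply: contraNneq dij => e.
by rewrite (mod_inj _ _ _ _ di dj e).
Qed.


Section Edges.
Variable D : {set 'I_n * 'I_n}.
Hypothesis D_lt : forall p, p \in D -> (p.1 < p.2)%N.

Definition edge_rel : rel 'I_n := fun i j => ((i, j) \in D) || ((j, i) \in D).

Lemma edge_rel_sym : symmetric edge_rel.
Proof. by move=> i j; rewrite /edge_rel orbC. Qed.

Lemma edge_rel_irr : irreflexive edge_rel.
Proof.
by move=> i; rewrite /edge_rel orbb; apply: contraTF isT => /D_lt; rewrite ltnn.
Qed.

Lemma card_edge_rel : #|[pred p | edge_rel p.1 p.2]| = (2 * #|D|)%N.
Proof.
pose sw (p : 'I_n * 'I_n) := (p.2, p.1).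
have swK : involutive sw by case.
transitivity #|D :|: sw @^-1: D|.
  by apply: eq_card => -[i j]; rewrite !inE.
rewrite cardsU disjoint_setI0 ?cards0 ?subn0; last first.
  rewrite disjoints_subset; apply/subsetP => p /D_lt p12; rewrite !inE.
  by apply: contraTN p12 => /D_lt /=; rewrite -leqNgt => /ltnW.
by rewrite mul2n -addnn on_card_preimset //; exists sw => p _; apply: swK.
Qed.

Lemma edge_proj_weight_disjoint : (forall i j, (i, j) \in D -> weight i j = 0%N) ->
  edge_proj edge_rel K = 0.
Proof.
move=> D0; apply/matrixP => i j; rewrite !mxE; case: ifP => // eij.
have w0 k l : (k, l) \in D -> weight k l = 0%N /\ weight l k = 0%N.
  move=> kl; split; first exact: D0.
  by rewrite /weight ltnNge (ltnW (D_lt kl)).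
by case/orP: eij => /w0 [-> ->]; rewrite !subrr mul0r.
Qed.

Lemma edge_proj_weight_contained :
    (forall i j : 'I_n, (i < j)%N -> weight i j != 0%N -> (i, j) \in D) ->
  edge_proj edge_rel K = K.
Proof.
move=> DK; apply/matrixP => i j; rewrite !mxE; case: ifP => [_|/negbT]; first by field.
rewrite negb_or => /andP[ij ji].
have w0 (k l : 'I_n) : (k, l) \notin D -> weight k l = 0%N.
  move=> kl; case: (ltnP k l) => lt_kl; last by rewrite /weight ltnNge lt_kl.
  by apply: contraNeq kl; apply: DK.
by rewrite !w0 // subrr.
Qed.

End Edges.

(** The available matrix units join the ends of paths of length two. In the star alone such paths
    never join the center to a leaf; the triangle [0, 1, 2] provides one, and products give the
    rest. *)
Lemma example_generated (PA : {linear Mn -> Mn}) (Z : rel 'I_n) (s : C)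
    (PA_proj : orthogonal_projection PA) (PA_diag : forall a, diagonal (PA a))
    (PA1 : PA 1%:M = 1%:M) (Z_sym : symmetric Z) (Z_irr : irreflexive Z)
    (Z_K : (s = 1 /\ edge_proj Z K = 0) \/ (s = -1 /\ edge_proj Z K = K))
    (distinct : forall i j, i != j -> PA (sandwich (example_proj PA Z s K) 1%:M) i i !=
      PA (sandwich (example_proj PA Z s K) 1%:M) j j) :
  forall v, generated (example_proj PA Z s K) v.
Proof.
have s0 : s != 0 by case: Z_K => -[-> _]; rewrite ?oppr_eq0 oner_neq0.
have gen := example_generated_delta PA_proj PA_diag Z_irr weight_mx_tr
  weight_mx_trace_neq0 s0 distinct.
have g0 i : i != o0 -> generated (example_proj PA Z s K) (delta_mx o0 i).
  move=> i0; have g01 : generated (example_proj PA Z s K) (delta_mx o0 o1).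
    apply: (gen _ _ o2); first exact: weight_mx_star.
    exact/weight_mx_sym_neq0/weight_mx12.
  rewrite -[delta_mx o0 i](mul_delta_mx o1); apply: generatedM => //.
  by apply: (gen _ _ o0); [apply: weight_mx_sym_neq0|]; apply: weight_mx_star.
have g0' i : i != o0 -> generated (example_proj PA Z s K) (delta_mx i o0).
  move=> i0; have g01 : generated (example_proj PA Z s K) (delta_mx o1 o0).
    apply: (gen _ _ o2); first exact: weight_mx12.
    by apply/weight_mx_sym_neq0/weight_mx_star.
  rewrite -[delta_mx i o0](mul_delta_mx o1); apply: generatedM => //.
  by apply: (gen _ _ o0); [apply: weight_mx_sym_neq0|]; apply: weight_mx_star.
have g00 : generated (example_proj PA Z s K) (delta_mx o0 o0).
  by rewrite -(mul_delta_mx o1); apply: generatedM; [apply: g0|apply: g0'].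
have gE i j : generated (example_proj PA Z s K) (delta_mx i j).
  rewrite -(mul_delta_mx o0); apply: generatedM.
    by have [->|] := eqVneq i o0; [exact: g00|exact: g0'].
  by have [->|] := eqVneq j o0; [exact: g00|exact: g0].
move=> v; rewrite [v]matrix_sum_delta; apply: generated_sum => i _.
by apply: generated_sum => j _; exact: generatedZ.
Qed.

(** Here [r] is the dimension of the operator system, one more than that of [W]. *)
Definition good_projection (r : nat) : Prop := exists P : {linear Mn -> Mn},
  [/\ orthogonal_projection P, P 1%:M = 1%:M, operator_trace P = r%:R &
      forall v, generated P v].

(** With the full diagonal, [PA] adds the same constant [1] to every entry, so the entries are
    distinct by [degree_shift_inj]. *)
Lemma diag_example (Z : rel 'I_n) (s : C) (z r : nat) :
    symmetric Z -> irreflexive Z ->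
    (s = 1 /\ edge_proj Z K = 0) \/ (s = -1 /\ edge_proj Z K = K) ->
    #|[pred p | Z p.1 p.2]| = (2 * z)%N -> r%:R = n%:R + z%:R + s -> good_projection r.
Proof.
move=> Zs Zi ZK cZ er; have dd : forall a, diagonal (diag_proj (a : Mn)).
  by move=> a i j /negbTE ij; rewrite mxE ij.
have d1 : diag_proj 1%:M = 1%:M :> Mn.
  by apply/matrixP => i j; rewrite !mxE; case: (i == j).
have [pd sd] := (@diag_projP R n, weight_mx_trace_neq0).
exists (example_proj (@diag_proj R n) Z s K); split.
- exact: (example_projP pd dd Zs Zi weight_mx_tr weight_mx_dagger sd ZK).
- exact: (example_proj1 (PA := @diag_proj R n) _ _ d1 weight_mx_tr).
- rewrite (example_proj_trace _ _ Zi sd) diag_proj_trace cZ er natrM; congr (_ + _ + _).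
  by rewrite mulrC mulKf // pnatr_eq0.
have dE i : diag_proj (delta_mx i i : Mn) i i = 1 by rewrite !mxE !eqxx.
apply: example_generated => // i j ij.
rewrite ![diag_proj _ _ _]mxE !eqxx !mulr1n.
rewrite !(example_sandwich1_diag (PA := @diag_proj R n) s K pd dd Zi) !dE -!addrA.
rewrite (inj_eq (addrI _)).
rewrite !sumr_const; apply: (degree_shift_inj (fun k => #|Z k|)) => //.
by case: ZK => -[->]; [left|right].
Qed.


Definition diag_of (x : 'I_n -> C) : Mn := \matrix_(i, j) (x i *+ (i == j)).

(** A diagonal part of dimension two only, which makes the small dimensions accessible. *)
Definition plane_proj (x : 'I_n -> C) (a : Mn) : Mn :=
  line_proj 1%:M a + line_proj (diag_of x) a.

Lemma plane_proj_linear x : linear (plane_proj x).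
Proof.
move=> c a b; rewrite /plane_proj (linearP (line_proj 1%:M)) (linearP (line_proj (diag_of x))).
by rewrite scalerDr addrACA.
Qed.
HB.instance Definition _ x :=
  GRing.isLinear.Build C Mn Mn *:%R (plane_proj x) (plane_proj_linear x).

Section Plane.
Variable x : 'I_n -> C.
Hypotheses (x_sum : \sum_i x i = 0) (x_conj : forall i, (x i)^* = x i)
  (x_sqr : \sum_i x i ^+ 2 != 0).

Lemma diag_of_diagonal : diagonal (diag_of x).
Proof. by move=> i j /negbTE ij; rewrite mxE ij. Qed.

Lemma diag_of_trace a : \tr (diag_of x *m a) = \sum_i x i * a i i.
Proof.
rewrite mxtrace_mulC mxtrace_diagonal; last exact: diag_of_diagonal.
by apply: eq_bigr => i _; rewrite mxE eqxx mulrC.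
Qed.

Lemma diag_of_sqr : \tr (diag_of x *m diag_of x) = \sum_i x i ^+ 2.
Proof. by rewrite diag_of_trace; apply: eq_bigr => i _; rewrite mxE eqxx expr2. Qed.

Let n_neq0 : n%:R != 0 :> C.
Proof. by rewrite pnatr_eq0 -lt0n; apply: leq_trans n_ge3. Qed.

Lemma trace_one_sqr : \tr (1%:M *m 1%:M : Mn) = n%:R.
Proof. by rewrite mulmx1 mxtrace1. Qed.

Lemma plane_projP : orthogonal_projection (plane_proj x).
Proof.
have [||s1 i1 d1] := @line_projP R n 1%:M; first by rewrite trace_one_sqr.
  by left; exact: dagger1.
have [||sX iX dX] := @line_projP R n (diag_of x); first by rewrite diag_of_sqr.
  left; apply/matrixP => i j; rewrite !mxE eq_sym rmorphMn /= x_conj.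
  by case: eqP => // ->.
have trX : \tr (diag_of x) = 0.
  by rewrite -[RHS]x_sum; apply: eq_bigr => i _; rewrite mxE eqxx.
split=> [a b|a|a].
- by rewrite /plane_proj mulmxDl mulmxDr !mxtraceD s1 sX.
- rewrite /plane_proj (linearD (line_proj 1%:M)) (linearD (line_proj (diag_of x))) /= i1 iX.
  rewrite [line_proj 1%:M (line_proj _ _)]line_proj_eq0; last first.
    by rewrite mul1mx /line_proj mxtraceZ trX mulr0.
  rewrite [line_proj _ (line_proj 1%:M _)]line_proj_eq0 ?addr0 ?add0r //.
  by rewrite /line_proj -scalemxAr !mulmx1 mxtraceZ trX mulr0.
- by rewrite /plane_proj d1 dX daggerD.
Qed.

Lemma plane_projE a i j :
  plane_proj x a i j =
    (\tr a / n%:R + \tr (diag_of x *m a) / (\sum_i x i ^+ 2) * x i) *+ (i == j).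
Proof.
rewrite mxE /line_proj mul1mx trace_one_sqr diag_of_sqr mxE [X in _ + X]mxE.
rewrite [diag_of x i j]mxE mxE.
by case: (i == j); rewrite ?mulr1n ?mulr0n ?mulr1 ?mulr0 ?addr0.
Qed.

Lemma plane_proj_diagonal a : diagonal (plane_proj x a).
Proof. by move=> i j /negbTE ij; rewrite plane_projE ij. Qed.

Lemma plane_proj1 : plane_proj x 1%:M = 1%:M.
Proof.
apply/matrixP => i j; rewrite plane_projE mxtrace1 divff // diag_of_trace.
rewrite [X in X / _](_ : _ = 0) ?mul0r ?addr0 ?mxE; first by case: (i == j).
by rewrite -[RHS]x_sum; apply: eq_bigr => k _; rewrite mxE eqxx mulr1.
Qed.

Lemma plane_proj_trace : operator_trace (plane_proj x) = 2.
Proof.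
transitivity (operator_trace (line_proj (1%:M : Mn)) + operator_trace (line_proj (diag_of x))).
  by rewrite -big_split; apply: eq_bigr => p _; rewrite mxE.
by rewrite !line_proj_trace ?trace_one_sqr ?diag_of_sqr.
Qed.

Lemma plane_proj_delta i :
  plane_proj x (delta_mx i i) i i = n%:R^-1 + x i ^+ 2 / (\sum_i x i ^+ 2).
Proof.
have tr1 : \tr (delta_mx i i : Mn) = 1.
  by rewrite -[delta_mx i i]mul1mx mulmx_delta mxE eqxx.
rewrite plane_projE eqxx mulr1n tr1.
by rewrite mulmx_delta mxE eqxx mul1r mulrAC expr2.
Qed.

End Plane.

(** The projected sandwich is a combination of [1] and [diag_of x]. Its entries are distinct when
    [x] is injective and the coefficient of [diag_of x] is nonzero; up to a nonzero factor, this
    coefficient is the last expression required of [x]. A centered arithmetic progression is used,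
    up to a transposition. *)
Lemma plane_example (Z : rel 'I_n) (s : C) (z r : nat) :
    symmetric Z -> irreflexive Z ->
    (s = 1 /\ edge_proj Z K = 0) \/ (s = -1 /\ edge_proj Z K = K) ->
    #|[pred p | Z p.1 p.2]| = (2 * z)%N -> r%:R = 2 + z%:R + s -> good_projection r.
Proof.
move=> Zs Zi ZK cZ er.
have s1 : s = 1 \/ s = -1 by case: ZK => -[->]; [left|right].
pose f i : C := (#|Z i|)%:R / 2 + s * ((K *m K) i i / \tr (K *m K)).
have f01 : f o0 != f o1 by apply: (degree_shift_inj (fun k => #|Z k|)).
suff [x [x_sum x_conj x_sqr x_inj xf]] : exists x : 'I_n -> C,
    [/\ \sum_i x i = 0, forall i, (x i)^* = x i, \sum_i x i ^+ 2 != 0, injective x &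
        \sum_i x i ^+ 3 / (\sum_i x i ^+ 2) + \sum_i x i * f i != 0].
  have pd := plane_projP x_sum x_conj x_sqr; have d1 := plane_proj1 x_sum.
  have dd := @plane_proj_diagonal x.
  have sd := weight_mx_trace_neq0.
  exists (example_proj (plane_proj x) Z s K); split.
  - exact: (example_projP pd dd Zs Zi weight_mx_tr weight_mx_dagger sd ZK).
  - exact: (example_proj1 (PA := plane_proj x) _ _ d1 weight_mx_tr).
  - rewrite (example_proj_trace _ _ Zi sd) plane_proj_trace // cZ er natrM; congr (_ + _ + _).
    by rewrite mulrC mulKf // pnatr_eq0.
  apply: example_generated => // i j ij.
  rewrite !plane_projE !eqxx !mulr1n (inj_eq (addrI _)).
  rewrite (inj_eq (mulfI _)) ?(inj_eq x_inj) // mulf_neq0 ?invr_eq0 //.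
  rewrite diag_of_trace; apply: contraNneq xf => e; apply/eqP; rewrite -[RHS]e.
  rewrite -big_split /=.
  transitivity (n%:R^-1 * \sum_i x i + \sum_i (x i ^+ 3 / (\sum_i0 x i0 ^+ 2) + x i * f i)).
    by rewrite x_sum mulr0 add0r.
  rewrite mulr_sumr -big_split; apply: eq_bigr => k _.
  rewrite (example_sandwich1_diag (PA := plane_proj x) s K pd dd Zi) plane_proj_delta.
  rewrite sumr_const /f; set S := \sum_i x i ^+ 2; set T := \tr _; set q := T^-1; set q' := S^-1.
  set q2 := 2^-1; set q3 := n%:R^-1; rewrite /=; ring.
(* Transposing two entries of [y] only changes the last sum, by                *)
(* [(y o1 - y o0) * (f o0 - f o1) != 0]: one of the two choices works.         *)
pose y (i : 'I_n) : C := (2 * i)%:R - n.-1%:R.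
have y_inj : injective y.
  by move=> i j /addIr/eqP; rewrite eqr_nat eqn_mul2l => /eqP; exact: val_inj.
have y_sum : \sum_i y i = 0.
  suff : (\sum_i y i) *+ 2 = 0 by move/eqP; rewrite mulrn_eq0 => /eqP.
  rewrite mulr2n [X in _ + X](reindex_inj rev_ord_inj) -big_split big1 //= => i _.
  rewrite /y /= addrACA -opprD -!natrD; apply/eqP; rewrite subr_eq0 eqr_nat.
  by have := ltn_ord i; lia.
have y_sqr : \sum_i y i ^+ 2 != 0.
  rewrite psumr_eq0 => [|i _]; last by rewrite real_exprn_even_ge0 // realB ?realn.
  apply/allPn; exists o0; rewrite ?mem_index_enum // sqrf_eq0 /y /= sub0r oppr_eq0 pnatr_eq0.
  by have := n_ge3; lia.
have perm_ok (p : {perm 'I_n}) :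
    \sum_i y (p i) ^+ 3 / (\sum_i y (p i) ^+ 2) + \sum_i y (p i) * f i != 0 ->
    exists x : 'I_n -> C, [/\ \sum_i x i = 0, forall i, (x i)^* = x i, \sum_i x i ^+ 2 != 0,
      injective x & \sum_i x i ^+ 3 / (\sum_i x i ^+ 2) + \sum_i x i * f i != 0].
  move=> pf; exists (y \o p); split=> //.
  - by rewrite -[RHS]y_sum [RHS](reindex_inj (@perm_inj _ p)).
  - by move=> i; rewrite /= /y rmorphB !rmorph_nat.
  - by rewrite (reindex_inj (@perm_inj _ p)) in y_sqr.
  - exact: inj_comp y_inj perm_inj.
have sum_perm (k : nat) (p : {perm 'I_n}) : \sum_i y (p i) ^+ k = \sum_i y i ^+ k.
  by rewrite [RHS](reindex_inj (@perm_inj _ p)).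
have [c1|] := eqVneq (\sum_i y i ^+ 3 / (\sum_i y i ^+ 2) + \sum_i y i * f i) 0; last first.
  move=> c1; apply: (perm_ok 1%g).
  under eq_bigr do rewrite perm1; under [X in _ + X]eq_bigr do rewrite perm1.
  by rewrite sum_perm.
apply: (perm_ok (tperm o0 o1)).
suff e : \sum_i y (tperm o0 o1 i) * f i - \sum_i y i * f i != 0.
  apply: contraNneq e => c2; rewrite -!mulr_suml !sum_perm mulr_suml in c2.
  rewrite -(addrKA (\sum_i y i ^+ 3 / (\sum_i y i ^+ 2))).
  by rewrite ![_ + \sum_i y i ^+ 3 / _]addrC c1 c2 subrr.
rewrite -sumrB.
rewrite (bigD1 o0) //= (bigD1 o1) //= big1 ?addr0 => [|i /andP[i0 i1]].
  rewrite tpermL tpermR.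
  have -> : y o1 * f o0 - y o0 * f o0 + (y o0 * f o1 - y o1 * f o1) =
      (y o1 - y o0) * (f o0 - f o1).
    by ring.
  by rewrite mulf_neq0 // subr_eq0 // (inj_eq y_inj).
by rewrite tpermD ?subrr // eq_sym.
Qed.

End Instances.

(** * Reaching every dimension in the range *)

Lemma subset_of_card (T : finType) (A B : {set T}) k :
    A \subset B -> (#|A| <= k <= #|B|)%N ->
  exists D : {set T}, [/\ A \subset D, D \subset B & #|D| = k].
Proof.
move=> AB; elim: k => [|k IH] /andP[Ak kB].
  by exists A; split=> //; apply/eqP; rewrite -leqn0.
have [Ak'|] := leqP #|A| k; last first.
  by move=> kA; exists A; split=> //; apply/eqP; rewrite eqn_leq Ak kA.
have [|D [AD DB cD]] := IH; first by rewrite Ak' ltnW.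
have [x] : exists x, x \in B :\: D.
  by apply/set0Pn; rewrite -card_gt0 cardsD (setIidPr DB) cD subn_gt0.
rewrite !inE => /andP[xD xB]; exists (x |: D); split.
- exact: subset_trans AD (subsetUr _ _).
- by rewrite subUset sub1set xB.
- by rewrite cardsU1 xD cD.
Qed.

Section Existence.
Variables (R : realType) (n : nat).
Hypothesis n_ge3 : (3 <= n)%N.
Local Notation C := R[i].
Local Notation Mn := 'M[C]_n.

Section Complement.
Variable P : {linear Mn -> Mn}.
Hypotheses (P_proj : orthogonal_projection P) (P1 : P 1%:M = 1%:M).

(** The line of [1], which lies in the range of [P], is put back so that the new range contains the
    unit. *)
Definition complement_proj (a : Mn) : Mn := a - P a + line_proj 1%:M a.

Lemma complement_proj_linear : linear complement_proj.
Proof.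
move=> c a b; rewrite /complement_proj (linearP P) (linearP (line_proj 1%:M)).
set u := line_proj _ a; set v := line_proj _ b; apply/matrixP => i j; rewrite !mxE; ring.
Qed.
HB.instance Definition _ :=
  GRing.isLinear.Build C Mn Mn *:%R complement_proj complement_proj_linear.

Let n_neq0 : n%:R != 0 :> C.
Proof. by rewrite pnatr_eq0 -lt0n; apply: leq_trans n_ge3. Qed.

Let trace_one_neq0 : \tr (1%:M *m 1%:M : Mn) != 0.
Proof. by rewrite trace_one_sqr. Qed.

Lemma complement_projP : orthogonal_projection complement_proj.
Proof.
have [||s1 i1 d1] := @line_projP R n 1%:M; first exact: trace_one_neq0.
  by left; exact: dagger1.
have [sP iP dP] := P_proj.
have Pl a : P (line_proj 1%:M a) = line_proj 1%:M a by rewrite /line_proj linearZ P1.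
have lP a : line_proj 1%:M (P a) = line_proj 1%:M a by rewrite /line_proj -sP P1.
split=> [a b|a|a].
- rewrite /complement_proj !mulmxDl !mulmxDr mulNmx mulmxN !mxtraceD s1.
  by rewrite !(raddfN mxtrace) /= sP.
- rewrite /complement_proj !linearD !linearN /= Pl i1 lP iP; apply/matrixP => i j.
  by rewrite !mxE; ring.
- by rewrite /complement_proj dP d1 daggerD daggerB.
Qed.

Lemma complement_proj1 : complement_proj 1%:M = 1%:M.
Proof. by rewrite /complement_proj P1 subrr add0r line_proj_id. Qed.

Lemma complement_projE a i j :
  complement_proj a i j = a i j - P a i j + line_proj 1%:M a i j.
Proof. by rewrite mxE [X in X + _]mxE [X in _ + X + _]mxE. Qed.

Lemma complement_proj_trace :
  operator_trace complement_proj = (n ^ 2)%:R - operator_trace P + 1.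
Proof.
transitivity (\sum_(p : 'I_n * 'I_n) 1 - operator_trace P +
    operator_trace (line_proj (1%:M : Mn))); last first.
  by rewrite line_proj_trace // sumr_const card_prod card_ord -mulnn.
rewrite -sumrB -big_split; apply: eq_bigr => p _ /=.
by rewrite complement_projE [delta_mx _ _ _ _]mxE !eqxx.
Qed.

(** [P] is the identity minus [complement_proj] plus the projection on the line of [1], and
    [sandwich] is linear in the projection: the identity gives [\tr v *: 1], the line of [1] a
    multiple of [v]. *)
Lemma complement_generated v : generated P v -> generated complement_proj v.
Proof.
have gline u : generated complement_proj (line_proj 1%:M u).
  exact/generatedZ/generated1.
case=> t <- {v}; elim: t => [|t gt u gu|c t gt|t gt u gu|t gt|t gt] /=.
- exact: generated1.
- exact: generatedD.
- exact: generatedZ.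
- exact: generatedM.
- have -> : P (term_eval P t) = term_eval P t - complement_proj (term_eval P t)
      + line_proj 1%:M (term_eval P t).
    by rewrite /complement_proj opprD opprB addrA addrNK addrC addrNK.
  apply: generatedD => //; apply: generatedB => //; exact: generated_proj.
set v := term_eval P t in gt *.
have -> : sandwich P v = \tr v *: 1%:M - sandwich complement_proj v + n%:R^-1 *: v.
  have -> : n%:R^-1 *: v = sandwich (line_proj 1%:M) v.
    by rewrite line_proj_sandwich trace_one_sqr mul1mx mulmx1.
  apply/matrixP => i j; rewrite !mxE.
  have -> : \tr v * (i == j)%:R = \sum_p \sum_q (delta_mx j q : Mn) i p * v p q.
    rewrite mulr_suml; apply: eq_bigr => p _; rewrite (bigD1 p) //= big1 => [|q qp].
      by rewrite addr0 mxE eqxx andbT mulrC.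
    by rewrite mxE [p == q]eq_sym (negbTE qp) andbF mul0r.
  rewrite -sumrB -big_split; apply: eq_bigr => p _.
  rewrite /= -sumrB -big_split; apply: eq_bigr => q _ /=.
  by rewrite complement_projE; ring.
apply: generatedD; last exact: generatedZ.
apply: generatedB; first exact/generatedZ/generated1.
exact: generated_sandwich.
Qed.

End Complement.

Lemma good_projection_complement r : (r <= n ^ 2)%N ->
  good_projection R n r -> good_projection R n (n ^ 2 - r).+1.
Proof.
move=> rn [P [PP P1 trP genP]]; exists (complement_proj P); split.
- exact: complement_projP.
- exact: complement_proj1.
- by rewrite complement_proj_trace trP -natrB // natr1.
- by move=> v; apply: complement_generated.
Qed.

Let o0 : 'I_n := Ordinal (leq_trans (isT : (0 < 3)%N) n_ge3).
Let o1 : 'I_n := Ordinal (leq_trans (isT : (1 < 3)%N) n_ge3).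
Let o2 : 'I_n := Ordinal (leq_trans (isT : (2 < 3)%N) n_ge3).

Let pairs : {set 'I_n * 'I_n} := [set p : 'I_n * 'I_n | (p.1 < p.2)%N].
Let support : {set 'I_n * 'I_n} := [set p in pairs | weight p.1 p.2 != 0%N].

Lemma card_pairs : (2 * #|pairs| + n = n ^ 2)%N.
Proof.
have -> : (n ^ 2 = #|{: 'I_n * 'I_n}|)%N by rewrite card_prod card_ord -mulnn.
pose sw (p : 'I_n * 'I_n) := (p.2, p.1).
have swK : involutive sw by case.
pose dg := [set (i, i) | i : 'I_n].
have cdg : #|dg| = n by rewrite card_imset ?card_ord // => i j [].
rewrite -(cardsC pairs) mul2n -addnn -addnA; congr (_ + _)%N.
rewrite -{1}(@on_card_preimset _ _ sw pairs); last by exists sw => p _; apply: swK.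
transitivity (#|sw @^-1: pairs| + #|dg|)%N; first by rewrite cdg.
rewrite -cardsUI [X in (_ + X)%N](_ : _ = 0%N) ?addn0; last first.
  apply: eq_card0 => p; rewrite !inE; apply/negbTE/negP => /andP[lt /imsetP[i _ ep]].
  by rewrite ep ltnn in lt.
apply: eq_card => -[i j]; rewrite !inE -leqNgt /= [RHS]leq_eqVlt orbC; congr (_ || _).
apply/imsetP/eqP => [[k _ [-> ->]] //|/val_inj ->]; by exists i.
Qed.

(** The [n - 1] edges of the star, and the edge [1 -- 2]. *)
Lemma card_support : (#|support| <= n)%N.
Proof.
have sub : support \subset (o1, o2) |: [set (o0, i) | i in [set~ o0]].
  apply/subsetP => -[i j]; rewrite !inE /weight /= => /andP[ij]; rewrite ij.
  case: (val i =P 0%N) => [i0 _|_]; last first.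
    rewrite eqb0 negbK => /andP[/eqP i1 /eqP j2]; apply/orP; left.
    by apply/eqP; congr pair; apply: val_inj.
  apply/orP; right; apply/imsetP; exists j; last by congr pair; apply: val_inj.
  by rewrite !inE -val_eqE /= -lt0n -i0.
apply: leq_trans (subset_leq_card sub) _; rewrite cardsU1.
apply: leq_trans (leq_add (leq_b1 _) (leq_imset_card _ _)) _.
by rewrite cardsC1 card_ord add1n prednK // (leq_trans _ n_ge3).
Qed.

(* With [N] the number of pairs: [2 <= d < n] is reached by [plane_example] with *)
(* [s = 1], [n <= d <= N] by [plane_example] with [s = -1],                      *)
(* [N < d <= N + n - 2] by [diag_example], and the rest by complementation.      *)
Lemma good_projection_exists d : (2 <= d <= n ^ 2 - 3)%N -> good_projection R n d.+1.
Proof.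
move=> /andP[d2 dn]; have cU := card_pairs; have cE := card_support.
have EU : support \subset pairs by apply/subsetP => p; rewrite inE => /andP[].
(* This is [(n - 2) * (n - 3) >= 0]. It leaves at least [n - 3] pairs outside the support, as many
   as the case [e < n] can ask for. *)
have sq : (5 * n <= n ^ 2 + 6)%N by rewrite -mulnn; have := n_ge3; clear; nia.
have [N pairsN] : exists N, #|pairs| = N by eexists.
have [c supportc] : exists c, #|support| = c by eexists.
have [M nM] : exists M, (n ^ 2)%N = M by eexists.
rewrite pairsN nM in cU; rewrite supportc in cE; rewrite nM in dn sq.
have lt_of (D : {set 'I_n * 'I_n}) : D \subset pairs -> forall p, p \in D -> (p.1 < p.2)%N.
  by move=> /subsetP DU p /DU; rewrite inE.
have contained (D : {set 'I_n * 'I_n}) : support \subset D ->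
    forall i j : 'I_n, (i < j)%N -> weight i j != 0%N -> (i, j) \in D.
  by move=> /subsetP ED i j ij wij; apply: ED; rewrite !inE /= ij.
have small e : (2 <= e <= N)%N -> good_projection R n e.+1.
  move=> /andP[e2 eN]; have [en|ne] := ltnP e n.
    have [|D [_ DE cD]] := @subset_of_card _ set0 (pairs :\: support) (e - 2) (sub0set _).
      rewrite cards0 cardsD (setIidPr EU) pairsN supportc /=; lia.
    have DU : D \subset pairs by apply: subset_trans DE (subsetDl _ _).
    apply: (plane_example n_ge3 (edge_rel_sym D) (edge_rel_irr (lt_of D DU))
      (s := 1) (z := (e - 2)%N)).
    - left; split=> //; apply: edge_proj_weight_disjoint (lt_of D DU) _ => i j ij.
      have := subsetP DE _ ij; have := subsetP DU _ ij; rewrite !inE /= => -> /=.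
      by rewrite andbT negbK => /eqP.
    - by rewrite (card_edge_rel (lt_of D DU)) cD.
    - by rewrite natrB // -natr1; ring.
  have [|D [ED DU cD]] := @subset_of_card _ support pairs e EU.
    by rewrite pairsN supportc eN andbT (leq_trans cE).
  apply: (plane_example n_ge3 (edge_rel_sym D) (edge_rel_irr (lt_of D DU)) (s := -1) (z := e)).
  - by right; split=> //; apply: edge_proj_weight_contained; exact: contained ED.
  - by rewrite (card_edge_rel (lt_of D DU)) cD.
  - by rewrite -natr1; ring.
have [dN|Nd] := leqP d N; first by apply: small; rewrite d2.
have [dN'|Nd'] := leqP d (N + n - 2).
  have [|D [ED DU cD]] := @subset_of_card _ support pairs (d + 2 - n)%N EU.
    by rewrite pairsN supportc; lia.
  apply: (diag_example n_ge3 (edge_rel_sym D) (edge_rel_irr (lt_of D DU))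
    (s := -1) (z := (d + 2 - n)%N)).
  - by right; split=> //; apply: edge_proj_weight_contained; exact: contained ED.
  - by rewrite (card_edge_rel (lt_of D DU)) cD.
  - rewrite natrB ?natrD -?natr1; last by lia.
    by ring.
(* The complementary [n ^ 2 - 1 - d] is at most [N], and at least [2] because [d <= n ^ 2 - 3]. *)
have -> : d.+1 = (n ^ 2 - (n ^ 2 - 1 - d).+1).+1 by rewrite nM; lia.
apply: good_projection_complement; first by rewrite nM; lia.
by apply: small; rewrite nM; lia.
Qed.

End Existence.

(** * Polynomial functions on a chart of the Grassmannian *)

Module Form.
Import mpoly.
Section Form.
Variables (N : nat) (K : comNzRingType).
Implicit Types f g : ('I_N -> K) -> K.

Definition is_form k f : Prop := exists p : {mpoly K[N]},
  MPoly.homogeneous k p /\ forall v, MPoly.eval v p = f v.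

Lemma is_form_const c : is_form 0 (fun=> c).
Proof.
exists c%:MP; split; last by move=> v; rewrite /MPoly.eval mevalC.
rewrite /MPoly.homogeneous -[c%:MP]mulr1 mul_mpolyC; apply: dhomogZ; exact: dhomog1.
Qed.

Lemma is_form_var i : is_form 1 (fun v => v i).
Proof.
exists 'X_i; split; last by move=> v; rewrite /MPoly.eval mevalXU.
by rewrite /MPoly.homogeneous dhomogX /= mdeg1.
Qed.

Lemma is_form_add k f g : is_form k f -> is_form k g -> is_form k (fun v => f v + g v).
Proof.
move=> [p [hp ep]] [q [hq eq]]; exists (p + q); split; first exact: dhomogD.
by move=> v; rewrite /MPoly.eval mevalD -ep -eq.
Qed.

Lemma is_form_mul k l f g :
  is_form k f -> is_form l g -> is_form (k + l) (fun v => f v * g v).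
Proof.
move=> [p [hp ep]] [q [hq eq]]; exists (p * q); split; first exact: dhomogM.
by move=> v; rewrite /MPoly.eval mevalM -ep -eq.
Qed.

End Form.
End Form.

Section Regular.
Variables (R : realType) (n d : nat).
Local Notation C := R[i].
Local Notation Mn := 'M[C]_n.
Local Notation coords := 'M[R]_(d, n * n).

Definition coord_mx (w : d.-tuple Mn) : coords := \matrix_(i, j) sa_coord (tnth w i) 0 j.

Definition minor (A : coords) (s : pluecker_index n d) : R := \det (colsub s A).

Lemma plueckerE w s : pluecker w s = minor (coord_mx w) s.
Proof. by congr (\det _); apply/matrixP => i j; rewrite !mxE. Qed.

Variable s0 : pluecker_index n d.

(* On the chart where the minor [s0] is invertible: the reduced matrix with    *)
(* the same row space whose submatrix on the columns [s0] is the identity.     *)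
Definition echelon (A : coords) : coords := invmx (colsub s0 A) *m A.

Definition exchange (i : 'I_d) (c : 'I_(n * n)) : pluecker_index n d :=
  [ffun k => if k == i then c else s0 k].

(* Cramer's rule. *)
Lemma echelon_minor A i c : minor A s0 != 0 ->
  minor A (exchange i c) = minor A s0 * echelon A i c.
Proof.
move=> A0; have uA : colsub s0 A \in unitmx by rewrite unitmxE unitfE.
rewrite /echelon /invmx uA -scalemxAl mxE mulrA divff // mul1r mxE.
rewrite /minor (expand_det_col _ i); apply: eq_bigr => k _.
rewrite !mxE ffunE eqxx mulrC; congr (_ * _).
rewrite /cofactor; congr (_ * \det _); apply/matrixP => p q; rewrite !mxE ffunE.
by rewrite eq_sym (negbTE (neq_lift _ _)).
Qed.

Local Notation pluecker_fun := (('I_#|{: pluecker_index n d}| -> R) -> R).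

(** A regular function on the affine chart: a form of degree [k] divided by the [k]-th power of the
    coordinate [s0]. *)
Definition regular (f : coords -> R) : Prop := exists k (F : pluecker_fun),
  Form.is_form k F /\ forall A, minor A s0 != 0 ->
    F (fun i => minor A (enum_val i)) = minor A s0 ^+ k * f (echelon A).

Lemma regular_ext f g : f =1 g -> regular f -> regular g.
Proof. by move=> fg [k [F [hF eF]]]; exists k, F; split=> // A A0; rewrite -fg eF. Qed.

Lemma regular_const c : regular (fun=> c).
Proof.
exists 0%N, (fun=> c); split; first exact: Form.is_form_const.
by move=> A _; rewrite expr0 mul1r.
Qed.

Lemma regular_coord i c : regular (fun E => E i c).
Proof.
exists 1%N, (fun v => v (enum_rank (exchange i c))); split; first exact: Form.is_form_var.
by move=> A A0; rewrite enum_rankK echelon_minor // expr1.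
Qed.

Lemma is_form_minor k : Form.is_form k ((fun v => v (enum_rank s0) ^+ k) : pluecker_fun).
Proof.
elim: k => [|k IH]; first exact: Form.is_form_const.
have [p [hp ep]] := Form.is_form_mul (Form.is_form_var R (enum_rank s0)) IH.
by exists p; split=> // v; rewrite ep exprS.
Qed.

Lemma regular_add f g : regular f -> regular g -> regular (fun E => f E + g E).
Proof.
move=> [k [F [hF eF]]] [l [G [hG eG]]].
exists (k + l)%N, (fun v => F v * v (enum_rank s0) ^+ l + v (enum_rank s0) ^+ k * G v); split.
  by apply: Form.is_form_add; apply: Form.is_form_mul => //; exact: is_form_minor.
move=> A A0; rewrite eF // eG // enum_rankK exprD; ring.
Qed.

Lemma regular_mul f g : regular f -> regular g -> regular (fun E => f E * g E).
Proof.
move=> [k [F [hF eF]]] [l [G [hG eG]]].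
exists (k + l)%N, (fun v => F v * G v); split; first exact: Form.is_form_mul.
by move=> A A0; rewrite eF // eG // exprD; ring.
Qed.

Lemma regular_opp f : regular f -> regular (fun E => - f E).
Proof.
move=> rf; apply: (regular_ext (f := fun E => -1 * f E)) => [E|]; first by rewrite mulN1r.
exact: regular_mul (regular_const _) rf.
Qed.

(** Forms have real coefficients, so a complex function is treated as a pair of real ones. *)
Definition cregular (f : coords -> C) : Prop :=
  regular (fun E => complex.Re (f E)) /\ regular (fun E => complex.Im (f E)).

Lemma cregular_const c : cregular (fun=> c).
Proof. by split; exact: regular_const. Qed.

Lemma cregular_ext f g : f =1 g -> cregular f -> cregular g.
Proof.
by move=> fg [r i]; split; [apply: regular_ext r|apply: regular_ext i] => E; rewrite fg.
Qed.

Lemma cregular_add f g : cregular f -> cregular g -> cregular (fun E => f E + g E).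
Proof.
move=> [rf jf] [rg jg]; split.
  apply: regular_ext (regular_add rf rg) => E; by case: (f E) (g E) => [a b] [a' b'].
apply: regular_ext (regular_add jf jg) => E; by case: (f E) (g E) => [a b] [a' b'].
Qed.

Lemma cregular_mul f g : cregular f -> cregular g -> cregular (fun E => f E * g E).
Proof.
move=> [rf jf] [rg jg]; split.
  apply: regular_ext (regular_add (regular_mul rf rg) (regular_opp (regular_mul jf jg))) => E.
  by case: (f E) (g E) => [a b] [a' b'].
apply: regular_ext (regular_add (regular_mul rf jg) (regular_mul jf rg)) => E.
by case: (f E) (g E) => [a b] [a' b'].
Qed.

Lemma cregular_sum (I : Type) (r : seq I) (P : pred I) (f : I -> coords -> C) :
  (forall i, cregular (f i)) -> cregular (fun E => \sum_(i <- r | P i) f i E).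
Proof.
move=> rf; elim: r => [|i r IH].
  by apply: cregular_ext (cregular_const 0) => E; rewrite big_nil.
apply: (cregular_ext (f := fun E => (if P i then f i E else 0) + \sum_(i <- r | P i) f i E)).
  by move=> E; rewrite big_cons; case: ifP; rewrite ?add0r.
by apply: cregular_add => //; case: (P i); [exact: rf|exact: cregular_const].
Qed.

Lemma cregular_prod (I : Type) (r : seq I) (P : pred I) (f : I -> coords -> C) :
  (forall i, cregular (f i)) -> cregular (fun E => \prod_(i <- r | P i) f i E).
Proof.
move=> rf; elim: r => [|i r IH].
  by apply: cregular_ext (cregular_const 1) => E; rewrite big_nil.
apply: (cregular_ext (f := fun E => (if P i then f i E else 1) * \prod_(i <- r | P i) f i E)).
  by move=> E; rewrite big_cons; case: ifP; rewrite ?mul1r.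
by apply: cregular_mul => //; case: (P i); [exact: rf|exact: cregular_const].
Qed.

Definition mx_regular p q (F : coords -> 'M[C]_(p, q)) : Prop :=
  forall i j, cregular (fun E => F E i j).

Lemma mx_regular_const p q (M : 'M[C]_(p, q)) : mx_regular (fun=> M).
Proof. by move=> i j; exact: cregular_const. Qed.

Lemma mx_regular_add p q (F G : coords -> 'M[C]_(p, q)) :
  mx_regular F -> mx_regular G -> mx_regular (fun E => F E + G E).
Proof.
by move=> rF rG i j; apply: cregular_ext (cregular_add (rF i j) (rG i j)) => E; rewrite mxE.
Qed.

Lemma mx_regular_scale p q (f : coords -> C) (F : coords -> 'M[C]_(p, q)) :
  cregular f -> mx_regular F -> mx_regular (fun E => f E *: F E).
Proof.
by move=> rf rF i j; apply: cregular_ext (cregular_mul rf (rF i j)) => E; rewrite mxE.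
Qed.

Lemma mx_regular_mul p q r (F : coords -> 'M[C]_(p, q)) (G : coords -> 'M[C]_(q, r)) :
  mx_regular F -> mx_regular G -> mx_regular (fun E => F E *m G E).
Proof.
move=> rF rG i j; apply: (cregular_ext (f := fun E => \sum_k F E i k * G E k j)).
  by move=> E; rewrite mxE.
by apply: cregular_sum => k; exact: cregular_mul.
Qed.

Lemma mx_regular_sum p q (I : Type) (r : seq I) (P : pred I)
    (F : I -> coords -> 'M[C]_(p, q)) :
  (forall i, mx_regular (F i)) -> mx_regular (fun E => \sum_(i <- r | P i) F i E).
Proof.
move=> rF i j; apply: (cregular_ext (f := fun E => \sum_(k <- r | P k) F k E i j)).
  by move=> E; rewrite summxE.
by apply: cregular_sum => k; exact: rF.
Qed.

Lemma cregular_det p (F : coords -> 'M[C]_p) :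
  mx_regular F -> cregular (fun E => \det (F E)).
Proof.
move=> rF; rewrite /determinant; apply: cregular_sum => s; apply: cregular_mul.
  exact: cregular_const.
by apply: cregular_prod => i; exact: rF.
Qed.

Lemma cregular_trace p (F : coords -> 'M[C]_p) :
  mx_regular F -> cregular (fun E => \tr (F E)).
Proof. by move=> rF; apply: cregular_sum => i; exact: rF. Qed.

Lemma mx_regular_adjugate p (F : coords -> 'M[C]_p) :
  mx_regular F -> mx_regular (fun E => \adj (F E)).
Proof.
move=> rF i j; apply: (cregular_ext (f := fun E => cofactor (F E) j i)).
  by move=> E; rewrite mxE.
apply: cregular_mul; first exact: cregular_const.
apply: cregular_det => k l; apply: cregular_ext (rF (lift j k) (lift i l)) => E.
by rewrite !mxE.
Qed.

End Regular.

(** * Self-adjoint matrices from real coordinates *)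

Section Coordinates.
Variables (R : realType) (n : nat).
Local Notation C := R[i].
Local Notation Mn := 'M[C]_n.

Definition sa_of_coord (r : 'rV[R]_(n * n)) : Mn := \matrix_(i, j)
  (let c k l := r 0 (mxvec_index k l) in
   Complex (if (i <= j)%N then c i j else c j i)
           (if i == j then 0 else if (i <= j)%N then - c j i else c i j)).

Lemma sa_of_coordK x : dagger x = x -> sa_of_coord (sa_coord x) = x.
Proof.
move=> xs; apply/matrixP => i j; rewrite mxE /= /sa_coord !mxvecE !mxE.
have xc k l : x k l = (x l k)^* by rewrite -{1}xs !mxE.
have re : complex.Re (x j i) = complex.Re (x i j) by rewrite xc; case: (x i j).
have im : complex.Im (x j i) = - complex.Im (x i j) by rewrite xc; case: (x i j).
case: (eqVneq i j) => [eij|].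
  subst j; rewrite leqnn; have /eqP := im; rewrite -subr_eq0 opprK -mulr2n mulrn_eq0 /=.
  by case: (x i i) => a b /= /eqP ->.
case: (ltngtP i j) => // [ij _|ij _|/val_inj ->]; rewrite ?eqxx //.
  by rewrite im opprK; case: (x i j).
by rewrite re; case: (x i j).
Qed.

Lemma sa_of_coord_dagger r : dagger (sa_of_coord r) = sa_of_coord r.
Proof.
apply/matrixP => i j; rewrite !mxE /=.
have [->|] := eqVneq i j; first by rewrite leqnn; apply/eqP; rewrite eq_complex /= oppr0 !eqxx.
move=> /negbTE ij.
case: (ltngtP i j) => [lt|lt|/val_inj e]; last by rewrite e eqxx in ij.
  by apply/eqP; rewrite eq_complex /= !eqxx.
by apply/eqP; rewrite eq_complex /= opprK !eqxx.
Qed.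

Lemma sa_of_coord_sum (I : finType) (a : I -> R) (r : I -> 'rV[R]_(n * n)) :
  sa_of_coord (\sum_k a k *: r k) = \sum_k (a k)%:C%C *: sa_of_coord (r k).
Proof.
apply/matrixP => i j; rewrite summxE.
have Zc (b : R) (z : C) : b%:C%C * z = Complex (b * complex.Re z) (b * complex.Im z).
  by case: z => x y; apply/eqP; rewrite eq_complex /= !mul0r subr0 addr0 !eqxx.
under [RHS]eq_bigr => k _ do rewrite mxE Zc.
have sumC (f g : I -> R) : \sum_k Complex (f k) (g k) = Complex (\sum_k f k) (\sum_k g k).
  elim/big_rec3: _ => // k x y z _ ->.
  by apply/eqP; rewrite eq_complex /= !eqxx.
rewrite sumC !mxE; congr Complex.
  by case ij: (i <= j)%N; rewrite summxE; apply: eq_bigr => k _; rewrite !mxE /= ij.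
case: (eqVneq i j) => [eij|/negbTE ij].
  by rewrite big1 // => k _; rewrite mxE /= eij eqxx mulr0.
case lij: (i <= j)%N; rewrite summxE -?sumrN; apply: eq_bigr => k _; rewrite !mxE /= ij lij //.
by rewrite mulrN.
Qed.

End Coordinates.

(** * Gram matrices and polynomial projections *)

Section Gram.
Variables (R : realType) (n m : nat) (b : 'I_m -> 'M[R[i]]_n).
Local Notation C := R[i].
Local Notation Mn := 'M[C]_n.

Definition gram : 'M[C]_m := \matrix_(i, j) \tr (b i *m b j).

(* The orthogonal projection on the span of [b], multiplied by the Gram        *)
(* determinant so as to be polynomial in [b].                                  *)
Definition gram_proj (a : Mn) : Mn :=
  \sum_i \sum_j ((\adj gram) i j * \tr (b j *m a)) *: b i.

Lemma gram_proj_linear : linear gram_proj.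
Proof.
move=> c x y; rewrite /gram_proj scaler_sumr -big_split; apply: eq_bigr => i _ /=.
rewrite scaler_sumr -big_split; apply: eq_bigr => j _ /=.
by rewrite mulmxDr -scalemxAr mxtraceD mxtraceZ mulrDr scalerDl scalerA mulrCA.
Qed.
HB.instance Definition _ :=
  GRing.isLinear.Build C Mn Mn *:%R gram_proj gram_proj_linear.

Lemma gram_tr : gram^T = gram.
Proof. by apply/matrixP => i j; rewrite !mxE mxtrace_mulC. Qed.

Lemma gram_proj_basis k : gram_proj (b k) = \det gram *: b k.
Proof.
transitivity (\sum_i (\adj gram *m gram) i k *: b i).
  apply: eq_bigr => i _; rewrite mxE scaler_suml; apply: eq_bigr => j _.
  by rewrite [gram _ _]mxE.
rewrite mul_adj_mx (bigD1 k) //= mxE eqxx big1 ?addr0 // => i /negbTE ik.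
by rewrite mxE ik scale0r.
Qed.

Lemma gram_proj_symmetric : trace_symmetric gram_proj.
Proof.
move=> x y; rewrite /gram_proj mulmx_suml mulmx_sumr !(raddf_sum mxtrace) /=.
under eq_bigr => i _ do rewrite mulmx_suml (raddf_sum mxtrace) /=.
under [RHS]eq_bigr => i _ do rewrite mulmx_sumr (raddf_sum mxtrace) /=.
rewrite exchange_big; apply: eq_bigr => i _; apply: eq_bigr => j _.
rewrite -scalemxAl -scalemxAr !mxtraceZ [\tr (x *m b i)]mxtrace_mulC.
have -> : (\adj gram) j i = (\adj gram) i j by rewrite -{1}gram_tr -trmx_adj mxE.
by ring.
Qed.

Section Span.
Variable V : {vspace Mn}.
Hypotheses (b_in : forall i, b i \in V)
  (b_span : forall x, x \in V -> exists c, x = \sum_i c i *: b i).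

Lemma gram_proj_in a : gram_proj a \in V.
Proof. by apply: memv_suml => i _; apply: memv_suml => j _; apply: memvZ. Qed.

Lemma gram_proj_id x : x \in V -> gram_proj x = \det gram *: x.
Proof.
move=> /b_span[c ->]; rewrite linear_sum scaler_sumr; apply: eq_bigr => i _.
by rewrite linearZ /= gram_proj_basis !scalerA mulrC.
Qed.

(** The adjoint of [P (gram_proj y) = gram_proj y] for the trace form is
    [gram_proj (P a) = gram_proj a], and [P a] lies in [V]. *)
Lemma gram_proj_unique (P : {linear Mn -> Mn}) :
    trace_symmetric P -> (forall a, P a \in V) -> (forall a, a \in V -> P a = a) ->
  forall a, gram_proj a = \det gram *: P a.
Proof.
move=> Ps Pin Pid a; rewrite -gram_proj_id //; apply: trace_nondegenerate => y.
by rewrite !gram_proj_symmetric Ps Pid // gram_proj_in.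
Qed.

End Span.

Lemma gram_det_free c : \det gram != 0 -> \sum_i c i *: b i = 0 -> forall i, c i = 0.
Proof.
move=> g0 bc i; have ug : gram \in unitmx by rewrite unitmxE unitfE.
have : (\row_j c j) *m gram = 0.
  apply/rowP => j; rewrite !mxE -[RHS](mxtrace0 C n) -(mul0mx _ (b j)) -bc mulmx_suml.
  rewrite (raddf_sum mxtrace); apply: eq_bigr => k _ /=.
  by rewrite -scalemxAl mxtraceZ !mxE.
by move/(canRL (mulmxK ug)); rewrite mul0mx => /rowP/(_ i); rewrite !mxE.
Qed.

(** A null vector of the Gram matrix gives an [x] orthogonal to the span. The span contains
    [dagger x], the [b i] being self-adjoint; hence [\tr (x *m dagger x) = 0] and [x = 0]. *)
Lemma gram_det_neq0 : (forall i, dagger (b i) = b i) ->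
  (forall c, \sum_i c i *: b i = 0 -> forall i, c i = 0) -> \det gram != 0.
Proof.
move=> b_sa b_free; apply/det0P => -[v v0 vg].
pose x := \sum_i v 0 i *: b i.
have xb j : \tr (x *m b j) = 0.
  have /rowP/(_ j) := vg; rewrite !mxE => <-; rewrite mulmx_suml (raddf_sum mxtrace).
  by apply: eq_bigr => k _ /=; rewrite -scalemxAl mxtraceZ mxE.
have xx : \tr (x *m dagger x) = 0.
  rewrite (_ : dagger x = \sum_i (v 0 i)^* *: b i).
    rewrite mulmx_sumr (raddf_sum mxtrace) big1 // => k _ /=.
    by rewrite -scalemxAr mxtraceZ xb mulr0.
  rewrite /x; elim/big_rec2: _ => [|i y1 y2 _ <-].
    by apply/matrixP => i j; rewrite !mxE rmorph0.
  by rewrite daggerD daggerZ b_sa.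
case/negP: v0; apply/eqP/rowP => i; rewrite mxE; apply: (b_free (v 0)).
rewrite -/x; apply/matrixP => k l; rewrite mxE; apply/eqP; rewrite -normr_eq0 -sqrf_eq0.
move: xx; rewrite /mxtrace.
under eq_bigr => p _ do rewrite mxE.
rewrite pair_big /=; under eq_bigr => p _ do rewrite !mxE -normCK.
by move/psumr_eq0P => /(_ (fun p _ => exprn_ge0 2 (normr_ge0 _)) (k, l) isT) /= ->.
Qed.

End Gram.

(** * Regularity of the evaluated expressions *)

Section RegularTerms.
Variables (R : realType) (n d m : nat) (s0 : pluecker_index n d).
Local Notation C := R[i].
Local Notation Mn := 'M[C]_n.
Local Notation coords := 'M[R]_(d, n * n).

Lemma mx_regular_sa_of_coord i : mx_regular s0 (fun E : coords => sa_of_coord (row i E)).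
Proof.
have re c : regular s0 (fun E : coords => row i E 0 c).
  by apply: regular_ext (regular_coord R s0 i c) => E; rewrite mxE.
move=> k l; split.
  apply: (regular_ext (f := fun E : coords => row i E 0
      (if (k <= l)%N then mxvec_index k l else mxvec_index l k))) => [E|]; last exact: re.
  by rewrite [sa_of_coord _ _ _]mxE /=; case: ifP.
case kl: (k == l).
  by apply: regular_ext (regular_const s0 0) => E; rewrite [sa_of_coord _ _ _]mxE /= kl.
case kl': (k <= l)%N.
  apply: (regular_ext (f := fun E : coords => - row i E 0 (mxvec_index l k))) => [E|].
    by rewrite [sa_of_coord _ _ _]mxE /= kl kl'.
  exact/regular_opp/re.
apply: (regular_ext (f := fun E : coords => row i E 0 (mxvec_index k l))) => [E|].
  by rewrite [sa_of_coord _ _ _]mxE /= kl kl'.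
exact: re.
Qed.

Variable b : coords -> 'I_m -> Mn.
Hypothesis rb : forall i, mx_regular s0 (fun E => b E i).

Lemma mx_regular_gram : mx_regular s0 (fun E => gram (b E)).
Proof.
move=> i j; apply: (cregular_ext (f := fun E => \tr (b E i *m b E j))) => [E|].
  by rewrite mxE.
exact/cregular_trace/mx_regular_mul.
Qed.

Lemma mx_regular_gram_proj (F : coords -> Mn) :
  mx_regular s0 F -> mx_regular s0 (fun E => gram_proj (b E) (F E)).
Proof.
move=> rF; apply: mx_regular_sum => i; apply: mx_regular_sum => j.
apply: mx_regular_scale => //; apply: cregular_mul.
  exact: mx_regular_adjugate mx_regular_gram _ _.
exact/cregular_trace/mx_regular_mul.
Qed.

Lemma mx_regular_term t : mx_regular s0 (fun E => term_eval (gram_proj (b E)) t).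
Proof.
elim: t => [|t rt u ru|c t rt|t rt u ru|t rt|t rt] /=.
- exact: mx_regular_const.
- exact: mx_regular_add.
- exact: mx_regular_scale (cregular_const _ _) rt.
- exact: mx_regular_mul.
- exact: mx_regular_gram_proj.
move=> i j; pose v E := term_eval (gram_proj (b E)) t.
apply: (cregular_ext
  (f := fun E => \sum_p \sum_q gram_proj (b E) (delta_mx j q) i p * v E p q)).
  by move=> E; rewrite mxE.
apply: cregular_sum => p; apply: cregular_sum => q; apply: cregular_mul; last exact: rt.
by apply: (mx_regular_gram_proj (F := fun=> delta_mx j q)); exact: mx_regular_const.
Qed.

End RegularTerms.

(** * Generic operator systems *)

Section Chart.
Variables (R : realType) (n d : nat).
Local Notation C := R[i].
Local Notation Mn := 'M[C]_n.
Local Notation coords := 'M[R]_(d, n * n).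

Definition system_basis (E : coords) (i : 'I_d.+1) : Mn :=
  if unlift ord0 i is Some j then sa_of_coord (row j E) else 1%:M.

Lemma system_basis0 E : system_basis E ord0 = 1%:M.
Proof. by rewrite /system_basis unlift_none. Qed.

Lemma system_basisS E j : system_basis E (lift ord0 j) = sa_of_coord (row j E).
Proof. by rewrite /system_basis liftK. Qed.

Lemma mx_regular_system_basis s0 i : mx_regular s0 (fun E => system_basis E i).
Proof.
case: (unliftP ord0 i) => [j ->|->] k l.
  have r := mx_regular_sa_of_coord R s0 j k l; apply: cregular_ext r => E.
  by rewrite system_basisS.
have r := cregular_const s0 ((1%:M : Mn) k l); apply: cregular_ext r => E.
by rewrite system_basis0.
Qed.

Lemma system_basis_dagger E i : dagger (system_basis E i) = system_basis E i.
Proof.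
case: (unliftP ord0 i) => [j ->|->]; first by rewrite system_basisS sa_of_coord_dagger.
by rewrite system_basis0 dagger1.
Qed.

Variables (s0 : pluecker_index n d) (W : {vspace Mn}) (w : d.-tuple Mn).
Hypotheses (wW : sa_basis W w) (minor0 : minor (coord_mx w) s0 != 0).

Local Notation E := (echelon s0 (coord_mx w)).
Local Notation V := (<[1%:M]> + W)%VS.

Lemma echelon_basis j : sa_of_coord (row j E) =
  \sum_k (invmx (colsub s0 (coord_mx w)) j k)%:C%C *: tnth w k.
Proof.
have [_ w_sa] := wW.
have -> : row j E = \sum_k invmx (colsub s0 (coord_mx w)) j k *: sa_coord (tnth w k).
  rewrite /echelon row_mul mulmx_sum_row; apply: eq_bigr => k _.
  by rewrite mxE; congr (_ *: _); apply/rowP => c; rewrite !mxE.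
by rewrite sa_of_coord_sum; apply: eq_bigr => k _; rewrite sa_of_coordK //; exact: w_sa.
Qed.

Lemma echelon_basis_inv k :
  tnth w k = \sum_j (coord_mx w k (s0 j))%:C%C *: sa_of_coord (row j E).
Proof.
have [_ w_sa] := wW; rewrite -{1}(sa_of_coordK (w_sa k)) -sa_of_coord_sum.
congr sa_of_coord; transitivity (row k (colsub s0 (coord_mx w) *m E)).
  rewrite /echelon mulKVmx ?unitmxE ?unitfE //.
  by apply/rowP => c; rewrite !mxE.
rewrite row_mul mulmx_sum_row; apply: eq_bigr => j _.
by rewrite !mxE.
Qed.

Lemma system_basis_in i : system_basis E i \in V.
Proof.
case: (unliftP ord0 i) => [j ->|->]; rewrite ?system_basisS ?system_basis0.
  apply: (subvP (addvSr _ _)); rewrite echelon_basis; apply: memv_suml => k _.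
  by apply: memvZ; apply: basis_mem (mem_tnth _ _); case: wW.
by apply: (subvP (addvSl _ _)); exact: memv_line.
Qed.

Lemma system_basis_span x : x \in V -> exists c, x = \sum_i c i *: system_basis E i.
Proof.
case/memv_addP => _ /vlineP[a ->] [y yW ->].
have [wb _] := wW; rewrite (coord_basis wb yW).
exists (fun i => if unlift ord0 i is Some j then
  \sum_k coord w k y * (coord_mx w k (s0 j))%:C%C else a).
rewrite big_ord_recl unlift_none system_basis0; congr (_ + _).
under eq_bigr => k _ do rewrite -tnth_nth echelon_basis_inv scaler_sumr.
rewrite exchange_big; apply: eq_bigr => j _.
rewrite liftK system_basisS scaler_suml; apply: eq_bigr => k _.
by rewrite scalerA.
Qed.

Lemma system_span : V = <<[tuple system_basis E i | i < d.+1]>>%VS.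
Proof.
apply/eqP; rewrite eqEsubv; apply/andP; split; last first.
  by apply/span_subvP => x /mapP[i _ ->]; exact: system_basis_in.
apply/subvP => x /system_basis_span[c ->]; apply: memv_suml => i _; apply: memvZ.
by apply: memv_span; apply: map_f; rewrite mem_enum.
Qed.

Hypothesis gram0 : \det (gram (system_basis E)) != 0.

Lemma system_dim : \dim V = d.+1.
Proof.
rewrite system_span; have /eqP -> : free [tuple system_basis E i | i < d.+1].
  apply/freeP => c bc; apply: (gram_det_free gram0); rewrite -[RHS]bc.
  by apply: eq_bigr => i _; rewrite -tnth_nth tnth_mktuple.
by rewrite size_tuple.
Qed.

Lemma system_operator_dsystem : operator_dsystem d V.
Proof.
split; last exact: system_dim.
split; first by apply: (subvP (addvSl _ _)); exact: memv_line.
move=> x /system_basis_span[c ->].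
have -> : (\sum_i c i *: system_basis E i) ^t Num.conj = \sum_i (c i)^* *: system_basis E i.
  rewrite -/(dagger _); elim/big_rec2: _ => [|i y z _ <-].
    by apply/matrixP => i j; rewrite !mxE rmorph0.
  by rewrite daggerD daggerZ system_basis_dagger.
by apply: memv_suml => i _; apply: memvZ; exact: system_basis_in.
Qed.

End Chart.

(** A basis extracted from a generating list keeps the properties shared by its members, here
    self-adjointness. *)
Lemma free_subseq (F : fieldType) (V : vectType F) (X : seq V) :
  exists Y, [/\ free Y, (<<Y>> = <<X>>)%VS & {subset Y <= X}].
Proof.
elim: X => [|x X [Y [fY sY YX]]]; first by exists [::]; rewrite nil_free.
have [xY|xY] := boolP (x \in <<Y>>%VS).
  exists Y; split=> // [|y /YX yX]; last by rewrite inE yX orbT.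
  rewrite span_cons -sY; apply/eqP; rewrite eqEsubv addvSr subv_add subvv andbT.
  by rewrite -memvE.
exists (x :: Y); rewrite free_cons xY fY !span_cons sY; split=> // y.
by rewrite !inE => /orP[->//|/YX ->]; rewrite orbT.
Qed.

(** The two factors of a rank factorization of an idempotent multiply to [1] in the other order. *)
Lemma mxtrace_idempotent (F : fieldType) m (A : 'M[F]_m) :
  A *m A = A -> \tr A = (\rank A)%:R.
Proof.
move=> AA; have rb : row_base A *m col_base A = 1%:M.
  have /row_freeP[B Bb] := row_base_free A.
  have /row_fullP[D Db] := col_base_full A.
  move: (row_base A) (col_base A) (mulmx_base A) Bb Db => rb cb bA Bb Db.
  have : cb *m (rb *m cb) *m rb = cb *m rb by rewrite mulmxA bA -mulmxA bA.
  move/(congr1 (fun M => D *m M *m B)) => /=.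
  by rewrite !mulmxA Db mul1mx -!mulmxA Bb mulmx1.
by rewrite -{1}(mulmx_base A) mxtrace_mulC rb mxtrace1.
Qed.

(** * The open set defined by an example *)

Section Generic.
Variables (R : realType) (n d : nat).
Hypothesis n_ge3 : (3 <= n)%N.
Local Notation C := R[i].
Local Notation Mn := 'M[C]_n.
Local Notation coords := 'M[R]_(d, n * n).

Definition term_mx (E : coords) (t : 'I_(n * n) -> term R) : 'M[C]_(n * n) :=
  \matrix_(i, j) mxvec (term_eval (gram_proj (system_basis E)) (t i)) 0 j.

(** The Gram determinant controls the dimension of the operator system, the other determinant the
    triviality of the action; their product yields a single form. *)
Definition quality t (E : coords) : C :=
  \det (gram (system_basis E)) * \det (term_mx E t).

Lemma cregular_quality s0 t : cregular s0 (quality t).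
Proof.
have rb := mx_regular_system_basis R s0.
apply: cregular_mul; first exact/cregular_det/mx_regular_gram.
apply: cregular_det => i j.
case/mxvec_indexP: j => k l.
have r := mx_regular_term rb (t i) k l; apply: cregular_ext r => E.
by rewrite mxE mxvecE.
Qed.

Lemma quality_trivial s0 (W : {vspace Mn}) (w : d.-tuple Mn) t :
    sa_basis W w -> minor (coord_mx w) s0 != 0 ->
    quality t (echelon s0 (coord_mx w)) != 0 ->
  operator_dsystem d (<[1%:M]> + W)%VS /\ Qut_opsys_trivial (<[1%:M]> + W)%VS.
Proof.
move=> wW minor0; rewrite mulf_eq0 negb_or => /andP[g0 t0].
split; first exact: system_operator_dsystem wW minor0 g0.
have n_gt0 : (0 < n)%N by apply: leq_trans n_ge3.
apply: Qut_opsys_trivialP => G alpha act pres.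
apply: (action_fixed n_gt0 act pres g0 _ _ (gram_proj_symmetric _) t0).
  by apply: gram_proj_in => i; apply: system_basis_in.
by apply: gram_proj_id => x; apply: system_basis_span.
Qed.

(** [Proj] and [Sandwich] depend linearly on the map, so [Scale] absorbs the factor. This carries
    generation from a projection to the corresponding [gram_proj]. *)
Lemma generated_scale (P Q : Mn -> Mn) (g : C) v :
  g != 0 -> (forall a, Q a = g *: P a) -> generated P v -> generated Q v.
Proof.
move=> g0 QP [t <-] {v}; elim: t => [|t gt u gu|c t gt|t gt u gu|t gt|t gt] /=.
- exact: generated1.
- exact: generatedD.
- exact: generatedZ.
- exact: generatedM.
- by rewrite -[P _](scalerK g0) -QP; apply/generatedZ/generated_proj.
have -> : sandwich P (term_eval P t) = g^-1 *: sandwich Q (term_eval P t).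
  apply/matrixP => i j; rewrite !mxE mulr_sumr; apply: eq_bigr => p _.
  rewrite mulr_sumr; apply: eq_bigr => q _.
  have -> : Q (delta_mx j q) i p = g * P (delta_mx j q) i p by rewrite QP mxE.
  by rewrite -mulrA mulKf.
exact/generatedZ/generated_sandwich.
Qed.

Section Example.
Variable P : {linear Mn -> Mn}.
Hypotheses (P_proj : orthogonal_projection P) (P1 : P 1%:M = 1%:M)
  (P_trace : operator_trace P = d.+1%:R) (P_gen : forall v, generated P v).

Let n_neq0 : n%:R != 0 :> C.
Proof. by rewrite pnatr_eq0 -lt0n; apply: leq_trans n_ge3. Qed.

(** Projection on the orthogonal complement of [1] in the range of [P]; its range is the [W] of the
    example. *)
Definition traceless_part (a : Mn) : Mn := P a - line_proj 1%:M a.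

Lemma traceless_part_linear : linear traceless_part.
Proof.
move=> c a b; rewrite /traceless_part (linearP P) (linearP (line_proj 1%:M)).
set u := line_proj _ a; set v := line_proj _ b; apply/matrixP => i j; rewrite !mxE; ring.
Qed.
HB.instance Definition _ :=
  GRing.isLinear.Build C Mn Mn *:%R traceless_part traceless_part_linear.

Lemma line1_proj x : line_proj 1%:M (P x) = line_proj 1%:M x.
Proof. by rewrite /line_proj -(proj_symmetric P_proj) P1. Qed.

Lemma proj_line1 x : P (line_proj 1%:M x) = line_proj 1%:M x.
Proof. by rewrite /line_proj linearZ P1. Qed.

Lemma line1_idem x : line_proj 1%:M (line_proj 1%:M x) = line_proj (1%:M : Mn) x.
Proof.
have [||_ -> //] := @line_projP R n 1%:M; first by rewrite trace_one_sqr.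
by left; exact: dagger1.
Qed.

Lemma proj_traceless x : P (traceless_part x) = traceless_part x.
Proof. by rewrite /traceless_part linearB /= (proj_idem P_proj) proj_line1. Qed.

Lemma line1_traceless x : line_proj 1%:M (traceless_part x) = 0.
Proof.
by rewrite /traceless_part (linearB (line_proj 1%:M)) /= line1_proj line1_idem subrr.
Qed.

Lemma traceless_idem x : traceless_part (traceless_part x) = traceless_part x.
Proof. by rewrite {1}/traceless_part proj_traceless line1_traceless subr0. Qed.

Lemma traceless_dagger x : traceless_part (dagger x) = dagger (traceless_part x).
Proof.
rewrite /traceless_part (proj_dagger P_proj) daggerB line_proj_dagger //.
by left; exact: dagger1.
Qed.

Lemma traceless_trace : operator_trace traceless_part = d%:R.
Proof.
transitivity (operator_trace P - operator_trace (line_proj (1%:M : Mn))).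
  rewrite -sumrB; apply: eq_bigr => p _.
  by rewrite /traceless_part mxE [X in _ + X]mxE.
by rewrite P_trace line_proj_trace ?trace_one_sqr // -natr1 addrK.
Qed.

Let L := lin_mx traceless_part.

Lemma rank_traceless : \rank L = d.
Proof.
have LL : L *m L = L.
  apply/row_matrixP => i; rewrite !rowE mulmxA.
  by rewrite !mul_rV_lin /= mxvecK traceless_idem.
apply/eqP; rewrite -(eqr_nat C) -(mxtrace_idempotent LL) -traceless_trace; apply/eqP.
rewrite /mxtrace (reindex _ (curry_mxvec_bij _ _)); apply: eq_bigr => -[i j] _ /=.
have -> k : L k k = ((delta_mx 0 k : 'rV_(n * n)) *m L) 0 k by rewrite -rowE [RHS]mxE.
by rewrite mul_rV_lin mxvecE vec_mx_delta.
Qed.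

Lemma sa_coord_sum_delta (x : Mn) : dagger x = x ->
  x = \sum_k (sa_coord x 0 k)%:C%C *: sa_of_coord (delta_mx 0 k).
Proof.
by move=> xs; rewrite -sa_of_coord_sum -row_sum_delta sa_of_coordK.
Qed.

Lemma sa_decomposition (x : Mn) : exists y z, [/\ dagger y = y, dagger z = z & x = y + 'i *: z].
Proof.
exists (2^-1 *: (x + dagger x)), ((2 * 'i)^-1 *: (x - dagger x)).
have dd : dagger (dagger x) = x by apply/matrixP => i j; rewrite !mxE conjCK.
have i0 := neq0Ci C.
split.
- by rewrite daggerZ daggerD dd fmorphV rmorph_nat addrC.
- rewrite daggerZ daggerB dd fmorphV rmorphM rmorph_nat /= conjCi mulrN invrN scaleNr.
  by rewrite -scalerN opprB.
apply/matrixP => i j; rewrite !mxE; field.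
by rewrite i0.
Qed.

(** The images of a real basis of the self-adjoint matrices are self-adjoint and span the range of
    [traceless_part]. The size of a basis extracted from them is the rank of an idempotent, known
    from its trace. *)
Lemma example_basis : exists (W : {vspace Mn}) (w : d.-tuple Mn),
  [/\ sa_basis W w, Gsa d W & forall x, (x \in W) <-> traceless_part x = x].
Proof.
pose X := [seq traceless_part (sa_of_coord (delta_mx 0 k)) | k : 'I_(n * n)].
have [Y [fY sY YX]] := free_subseq X.
have spanX x : traceless_part x \in <<X>>%VS.
  have sa y : dagger y = y -> traceless_part y \in <<X>>%VS.
    move=> /sa_coord_sum_delta ->; rewrite linear_sum; apply: memv_suml => k _.
    rewrite linearZ; apply: memvZ; apply: memv_span; apply: map_f.
    by rewrite mem_enum.
  have [y [z [ys zs ->]]] := sa_decomposition x.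
  by rewrite linearD linearZ; apply: memvD; [|apply: memvZ]; apply: sa.
have fixX x : x \in <<X>>%VS -> traceless_part x = x.
  move=> xX; have: x \in <<in_tuple X>>%VS by [].
  move/coord_span => ->; rewrite linear_sum; apply: eq_bigr => i _.
  rewrite linearZ /=; congr (_ *: _).
  have /mapP[k _ ->] : (in_tuple X)`_i \in X by apply: mem_nth.
  exact: traceless_idem.
have memX x : (x \in <<X>>%VS) <-> traceless_part x = x.
  by split; [exact: fixX|move=> <-; exact: spanX].
have sizeY : size Y = d.
  rewrite -rank_traceless; pose B := \matrix_(i < size Y) mxvec Y`_i.
  have rB : \rank B = size Y.
    apply/eqP/inj_row_free => c; rewrite mulmx_sum_row => cB.
    have /freeP fY' : free (in_tuple Y) by [].
    apply/rowP => i; rewrite mxE; apply: (fY' (fun k => c 0 k)).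
    apply: (can_inj mxvecK); rewrite linear0 -[RHS]cB linear_sum; apply: eq_bigr => k _.
    by rewrite linearZ rowK.
  rewrite -rB; apply/eqP; rewrite eqn_leq; apply/andP; split; apply: mxrankS.
    apply/row_subP => i; rewrite rowK.
    have YiX : Y`_i \in <<X>>%VS by rewrite -sY; apply: memv_span; exact: mem_nth.
    by rewrite -(fixX _ YiX) -mul_vec_lin submxMl.
  apply/row_subP => i; rewrite rowE mul_rV_lin.
  have := spanX (vec_mx (delta_mx 0 i)); rewrite -sY => xY.
  have: traceless_part (vec_mx (delta_mx 0 i)) \in <<in_tuple Y>>%VS by [].
  move/coord_span => e; rewrite [X in mxvec X]e linear_sum; apply: summx_sub => k _.
  rewrite linearZ scalemx_sub //=; have <- : row k B = mxvec Y`_k by rewrite rowK.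
  exact: row_sub.
have bw : basis_of <<X>>%VS Y by rewrite /basis_of sY eqxx.
pose w : d.-tuple Mn := tcast sizeY (in_tuple Y).
have wY : w = Y :> seq Mn by rewrite val_tcast.
exists <<X>>%VS, w; split=> //.
- split; first by rewrite wY.
  move=> i; have : tnth w i \in Y by rewrite -wY mem_tnth.
  by move=> /YX/mapP[k _ ->]; rewrite -[LHS]traceless_dagger sa_of_coord_dagger.
- split; last by rewrite (size_basis (X := w)) ?wY.
  by move=> x /memX ex; apply/memX; rewrite -[x ^t _]/(dagger x) traceless_dagger ex.
Qed.


(** Complex independence of [w] makes the real coordinate rows independent, so some maximal minor is
    nonzero. *)
Lemma minor_exists (W : {vspace Mn}) (w : d.-tuple Mn) : sa_basis W w ->
  exists s0, minor (coord_mx w) s0 != 0.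
Proof.
move=> [wb w_sa]; pose A := coord_mx w.
have fA : row_free A.
  apply: inj_row_free => c; rewrite mulmx_sum_row => cA.
  have /freeP wf := basis_free wb.
  apply/rowP => i; rewrite mxE; apply: (fmorph_inj (real_complex R)); rewrite rmorph0.
  apply: (wf (fun k => (c 0 k)%:C%C)).
  transitivity (sa_of_coord (\sum_k c 0 k *: row k A)).
    rewrite sa_of_coord_sum; apply: eq_bigr => k _; rewrite -tnth_nth; congr (_ *: _).
    rewrite -{1}(sa_of_coordK (w_sa k)); congr sa_of_coord.
    by apply/rowP => p; rewrite !mxE.
  rewrite cA; apply/matrixP => p q; rewrite !mxE /=.
  by apply/eqP; rewrite eq_complex /= !mxE oppr0 !if_same !eqxx.
have fT : row_full A^T by rewrite /row_full mxrank_tr.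
have := fullrowsub_unit fT; rewrite unitmxE unitfE -det_tr => u.
exists (fullrankfun fT); apply: contraNneq u => e; apply/eqP; rewrite -[RHS]e /minor.
by congr (\det _); apply/matrixP => p q; rewrite !mxE.
Qed.

Lemma example_quality : exists (W : {vspace Mn}) (w : d.-tuple Mn) s0 t,
  [/\ sa_basis W w, Gsa d W, minor (coord_mx w) s0 != 0 &
      quality t (echelon s0 (coord_mx w)) != 0].
Proof.
have [W [w [wW GW WP]]] := example_basis; have [s0 m0] := minor_exists wW.
set E := echelon s0 (coord_mx w); pose V := (<[1%:M]> + W)%VS.
have b_in i : system_basis E i \in V by exact: system_basis_in wW i.
have b_span x : x \in V -> exists c, x = \sum_i c i *: system_basis E i.
  by exact: system_basis_span wW m0 x.
have P_in x : P x \in V.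
  rewrite -(subrK (line_proj 1%:M x) (P x)) addrC; apply: memv_add.
    exact/memvZ/memv_line.
  by apply/WP; exact: traceless_idem.
have P_id x : x \in V -> P x = x.
  case/memv_addP => _ /vlineP[a ->] [y /WP yW ->].
  by rewrite linearD linearZ /= P1 -yW proj_traceless.
have g0 : \det (gram (system_basis E)) != 0.
  apply: gram_det_neq0; first exact: system_basis_dagger.
  have b_free : free [tuple system_basis E i | i < d.+1].
    rewrite /free -(system_span wW m0) size_tuple dimv_disjoint_sum.
      rewrite dim_vline (size_basis wW.1); suff -> : (1%:M : Mn) != 0 by [].
      apply: contraNneq n_neq0 => e; rewrite -(@trace_one_sqr R n) e mulmx0 mxtrace0.
      exact: eqxx.
    apply/eqP; rewrite -subv0; apply/subvP => x.
    rewrite memv_cap => /andP[/vlineP[a ->] /WP e].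
    have := line1_traceless (a *: 1%:M); rewrite e linearZ /= line_proj_id ?trace_one_sqr //.
    by move=> ->; exact: mem0v.
  move=> c bc; move/freeP: b_free; apply; rewrite -[RHS]bc.
  by apply: eq_bigr => i _; rewrite -tnth_nth tnth_mktuple.
have gP : forall a, gram_proj (system_basis E) a = \det (gram (system_basis E)) *: P a.
  exact: gram_proj_unique b_in b_span _ (proj_symmetric P_proj) P_in P_id.
(* Expressions for the matrix units in the order of [mxvec], so that [term_mx] is the identity. *)
have [t tE] : exists t : 'I_(n * n) -> term R, forall i,
    term_eval (gram_proj (system_basis E)) (t i) = vec_mx (delta_mx 0 i).
  apply: (@fin_all_exists _ (fun=> term R)
    (fun i t => term_eval (gram_proj (system_basis E)) t = vec_mx (delta_mx 0 i))).
  by move=> i; exact: generated_scale g0 gP (P_gen _).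
exists W, w, s0, t; split=> //; rewrite /quality -/E.
have -> : term_mx E t = 1%:M.
  by apply/matrixP => i j; rewrite !mxE tE vec_mxK mxE eqxx eq_sym.
by rewrite det1 mulr1.
Qed.

End Example.

Lemma generic_of_projection : good_projection R n d.+1 ->
  generic_dsystem d (@Qut_opsys_trivial R n).
Proof.
move=> [P [P_proj P1 P_trace P_gen]].
have [W0 [w0 [s0 [t [w0W GW0 m0 q0]]]]] := example_quality P_proj P1 P_trace P_gen.
have [rq iq] := cregular_quality s0 t.
(* The squared modulus of [quality] is a real function with the same zeros. *)
have [k [F [[p [hp ep]] eF]]] := regular_add (regular_mul rq rq) (regular_mul iq iq).
(* The additional factor [s0] makes the form vanish outside the chart, where [echelon] has no
   meaning. *)
have [p' [hp' ep']] :=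
  Form.is_form_mul (ex_intro _ p (conj hp ep)) (Form.is_form_var R (enum_rank s0)).
have evalE (w : d.-tuple Mn) : pluecker_eval w p' =
    F (fun i => minor (coord_mx w) (enum_val i)) * minor (coord_mx w) s0.
  rewrite /pluecker_eval (_ : (fun i => pluecker w (enum_val i)) =
      fun i => minor (coord_mx w) (enum_val i)) ?ep' ?enum_rankK //.
  by apply: funext => i; rewrite plueckerE.
have normE (z : C) :
    (complex.Re z * complex.Re z + complex.Im z * complex.Im z == 0) = (z == 0).
  case: z => a b /=; rewrite -!expr2 paddr_eq0 ?sqr_ge0 // !sqrf_eq0.
  by rewrite eq_complex.
have evalP (w : d.-tuple Mn) : (pluecker_eval w p' != 0) =
    (minor (coord_mx w) s0 != 0) && (quality t (echelon s0 (coord_mx w)) != 0).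
  rewrite evalE; have [->|m] := eqVneq (minor (coord_mx w) s0) 0.
    by rewrite mulr0 eqxx.
  rewrite eF //=; move: (quality _ _) => z.
  by rewrite !mulf_eq0 expf_eq0 (negbTE m) andbF orbF /= normE.
(* A closed set asks for vanishing on all the self-adjoint bases, so its complement asks for one
   basis without vanishing. *)
exists (fun W => Gsa d W /\ exists2 w, sa_basis W w & pluecker_eval w p' != 0); split.
- split=> [W []//|]; exists (eq p'); split=> [_ <-|W]; first by exists (k + 1)%N.
  split=> [[GW nU]|[GW Z]]; split=> //.
    move=> w wW _ <-; apply: contra_notP nU => /eqP pw; split=> //.
    by exists w.
  by move=> [_ [w wW /eqP]]; apply; exact: Z.
- by exists W0; split=> //; exists w0 => //; rewrite evalP m0.
by move=> W [_ [w wW]]; rewrite evalP => /andP[m q]; exact: quality_trivial wW m q.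
Qed.

End Generic.

Theorem theorem0p8 (R : realType) (n d : nat) (hn : (3 <= n)%N)
  (hd : (2 <= d <= n ^ 2 - 3)%N) :
  generic_dsystem d (@Qut_opsys_trivial R n).
Proof. exact/generic_of_projection/good_projection_exists. Qed.
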